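(* Let $n$ be a positive integer, let $\eta>0$ be a real number, and let $(X,d)$ be a doubling space of Assouad-Nagata dimension at most $n$. If $\mathcal{F}$ is the class of intersection graphs of families of $\eta$-round subsets of $(X,d)$, then $\operatorname{asdim}(\mathcal{F})\le n+1$.
   Context: Families are multisets and may be finite or infinite. The intersection graph of a family $\mathcal{A}$ of sets is the (finite or infinite) simple graph with vertex set $\mathcal{A}$ in which two distinct vertices (members) $S_1,S_2$ are adjacent iff $S_1\cap S_2\neq\emptyset$. Metric spaces are extended: $d(x,y)=+\infty$ is allowed. $B(x,r)$ denotes the ball $\{y\in X: d(x,y)\le r\}$, and $\operatorname{diam}(U)=\sup_{x,y\in U}d(x,y)$. A metric space $(X,d)$ is a doubling space if there is $C>0$ such that for every $r>0$, every ball of radius $r$ is contained in a union of at most $C$ balls of radius $r/2$. A subset $S$ of $X$ is $\eta$-round if $S$ has finite diameter and for every $v\in S$ and every $0<r\le\operatorname{diam}(S)$ there exists $v'\in S$ such that $B(v',\eta r)\subseteq S\cap B(v,r)$. For $r>0$ a collection $\mathcal{U}$ of subsets of $X$ is $r$-disjoint if $\inf_{u\in U,u'\in U'}d(u,u')>r$ for all distinct $U,U'\in\mathcal{U}$. For an integer $m\ge 0$, a function $g:\mathbb{R}_+\to\mathbb{R}_+$ is an $m$-dimensional control function for $(X,d)$ if for every real $r>0$ there is a cover $\mathcal{U}=\bigcup_{i=1}^{m+1}\mathcal{U}_i$ of $X$ with $\operatorname{diam}(U)\le g(r)$ for all $U\in\mathcal{U}$ and each $\mathcal{U}_i$ being $r$-disjoint.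 A dilation is a function $g(x)=cx$ for some constant $c>0$. The Assouad-Nagata dimension of $(X,d)$ is the least integer $m\ge 0$ such that some dilation is an $m$-dimensional control function for $(X,d)$ ($\infty$ if none exists). A graph $G$ is viewed as the extended metric space $(V(G),\operatorname{dist}_G)$, where $\operatorname{dist}_G(u,v)$ is the infimum of the number of edges of paths between $u$ and $v$. A class $\mathcal{G}$ of (finite or infinite) graphs has asymptotic dimension at most $m$ if some single function $g:\mathbb{R}_+\to\mathbb{R}_+$ is an $m$-dimensional control function for all graphs in $\mathcal{G}$; $\operatorname{asdim}(\mathcal{G})$ is the least such integer $m\ge 0$ ($\infty$ if none). *)

(* Defs.v *)
From HB Require Import structures.
From mathcomp Require Import all_boot all_order all_algebra.
From mathcomp Require Import all_classical all_reals ereal.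

Set Implicit Arguments.
Unset Strict Implicit.
Unset Printing Implicit Defensive.

Import Order.TTheory GRing.Theory Num.Theory.

Local Open Scope classical_set_scope.
Local Open Scope ring_scope.

Record extended_metric (R : realType) (X : Type) (d : X -> X -> \bar R) : Prop :=
  ExtendedMetric {
    emetric_ge0 : forall x y, (0 <= d x y)%E;
    emetric_eq0 : forall x y, d x y = 0%E <-> x = y;
    emetric_sym : forall x y, d x y = d y x;
    emetric_triangle : forall x y z, (d x z <= d x y + d y z)%E
  }.

Section MetricNotions.
Variables (R : realType) (X : Type) (d : X -> X -> \bar R).

Definition cball (x : X) (r : R) : set X := [set y | (d x y <= r%:E)%E].

(* [diam set0 = -oo], so finiteness is expressed as [diam S < +oo], which holds
   of the empty set. *)
Definition diam (U : set X) : \bar R := ereal_sup [set d x y | x in U & y in U].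

Definition doubling : Prop :=
  exists2 C : R, 0 < C &
    forall (r : R) (x : X), 0 < r ->
      exists (k : nat) (c : 'I_k -> X),
        k%:R <= C /\ cball x r `<=` \bigcup_i cball (c i) (r / 2).

Definition round (eta : R) (S : set X) : Prop :=
  (diam S < +oo)%E /\
  forall (v : X) (r : R), S v -> 0 < r -> (r%:E <= diam S)%E ->
    exists2 v', S v' & cball v' (eta * r) `<=` S `&` cball v r.

Definition rdisjoint (r : R) (U : set (set X)) : Prop :=
  forall A B : set X, U A -> U B -> A <> B ->
    (r%:E < ereal_inf [set d a b | a in A & b in B])%E.

(* A function from the nonnegative reals to themselves is represented by a total
   function on R, of which only the values at nonnegative arguments matter. *)
Definition control_function (m : nat) (g : R -> R) : Prop :=
  (forall r, 0 <= r -> 0 <= g r) /\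
  forall r, 0 < r ->
    exists U : 'I_m.+1 -> set (set X),
      [/\ \bigcup_(A in \bigcup_i U i) A = setT,
          forall A, (\bigcup_i U i) A -> (diam A <= (g r)%:E)%E
        & forall i, rdisjoint r (U i)].

End MetricNotions.

Definition dilation (R : realType) (g : R -> R) : Prop :=
  exists2 c : R, 0 < c & forall x, g x = c * x.

(* The least m such that P m, and +oo if there is none. *)
Definition least_nat (R : realType) (P : set nat) : \bar R :=
  ereal_inf [set (m%:R)%:E | m in P].

Lemma least_nat_leP (R : realType) (P : set nat) (n : nat) :
  (least_nat R P <= (n%:R)%:E)%E <-> exists2 m, P m & (m <= n)%N.
Proof.
split=> [le_n|[m Pm mn]]; last first.
  by apply: ge_ereal_inf; exists (m%:R)%:E; [exists m|rewrite lee_fin ler_nat].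
have /ereal_inf_lt[_ [m Pm <-]] : (least_nat R P < (n.+1%:R)%:E)%E.
  by apply: le_lt_trans le_n _; rewrite lte_fin ltr_nat.
by rewrite lte_fin ltr_nat ltnS; exists m.
Qed.

Definition assouad_nagata_dim (R : realType) (X : Type) (d : X -> X -> \bar R) :
    \bar R :=
  least_nat R [set m | exists2 g, dilation g & control_function d m g].

(* Classically every type carries an eqType structure (for instance through
   [{classic T}]), so that requiring one on the vertices loses no generality. *)
Record sgraph := SGraph {
  vertex : eqType;
  adj : rel vertex;
  adj_sym : symmetric adj;
  adj_irrefl : irreflexive adj
}.

Definition gdist (R : realType) (G : sgraph) (u v : vertex G) : \bar R :=
  ereal_inf [set ((size p)%:R)%:E | p in
    [set p : seq (vertex G) | [/\ path (@adj G) u p, uniq (u :: p) & last u p = v]]].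

Definition asdim (R : realType) (C : sgraph -> Prop) : \bar R :=
  least_nat R [set m | exists g : R -> R,
    forall G, C G -> control_function (@gdist R G) m g].

Section IntersectionGraph.
(* A multiset of subsets of X is an indexed family A; its members are the
   indices, so that repeated sets are distinct vertices. *)
Variables (X : Type) (I : eqType) (A : I -> set X).

Definition inter_adj : rel I := fun i j => (i != j) && `[< A i `&` A j !=set0 >].

Lemma inter_adj_sym : symmetric inter_adj.
Proof. by move=> i j; rewrite /inter_adj eq_sym setIC. Qed.

Lemma inter_adj_irrefl : irreflexive inter_adj.
Proof. by move=> i; rewrite /inter_adj eqxx. Qed.

Definition intersection_graph : sgraph := SGraph inter_adj_sym inter_adj_irrefl.

End IntersectionGraph.

Definition round_intersection_graphs (R : realType) (X : Type)
    (d : X -> X -> \bar R) (eta : R) (G : sgraph) : Prop :=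
  exists (I : eqType) (A : I -> set X),
    (forall i, round d eta (A i)) /\ G = intersection_graph A.

(* Main.v *)
Require Import Defs.
From Stdlib Require Import Relation_Operators Operators_Properties List.
From HB Require Import structures.
From mathcomp Require Import all_boot all_order all_algebra.
From mathcomp Require Import all_classical all_reals ereal.
From mathcomp Require Import zify ring lra.

Set Implicit Arguments.
Unset Strict Implicit.
Unset Printing Implicit Defensive.

(* By compactness the family may be assumed finite. Sort the sets into levels by the
   logarithm of their diameter, and let k(S) be the largest level of a set within
   graph distance R of S. Assouad-Nagata dimension n gives, at each scale, covers
   of X by n+1 families of cells; put S in V_c if the ball of radius R around S lies
   in a cell of the c-th family at scale k(S). The classes V_0, ..., V_n cover the
   graph. Chains of cells of one family and of bounded scale stay bounded, so the
   cells organise V_c into a tree, and by doubling and roundness only boundedly many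
   pairwise disjoint large sets meet a given cell: at the scale r << R, V_c has a
   tree-decomposition whose bags are covered by boundedly many balls. As for graphs
   of bounded treewidth, V_c then has a 2-colouring with bounded components, and the
   same holds after the contraction of bounded connected pieces. So, treating
   V_0, ..., V_n in turn, the walls between the two colours can be chosen away from
   the walls chosen before; the union of all the walls has bounded components and is
   the (n+2)-nd colour class, besides the V_c minus the walls. *)

(** * Chains and nearness *)

(** [near n] stands for being at distance at most [n]; the colouring arguments use only these axioms
    of the graph metric. *)
Record nearness (T : Type) (near : nat -> T -> T -> Prop) : Prop := Nearness {
  near_refl : forall n x, near n x x;
  near_sym : forall n x y, near n x y -> near n y x;
  near_trans : forall a b x y z, near a x y -> near b y z -> near (a + b) x z;
  near_le : forall a b x y, a <= b -> near a x y -> near b x y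
}.

Definition restr (T : Type) (P : T -> Prop) (L : T -> T -> Prop) : T -> T -> Prop :=
  fun x y => [/\ P x, P y & L x y].

Notation chain P L := (clos_refl_trans _ (restr P L)).

(** A bound on weak diameters: the distance is measured in the whole space. A [chain] may be empty,
    whence the assumption on its origin. *)
Definition bounded_chains (T : Type) (near : nat -> T -> T -> Prop)
    (P : T -> Prop) (L : T -> T -> Prop) (D : nat) : Prop :=
  forall x y, P x -> chain P L x y -> near D x y.

Definition scattered (T : Type) (near : T -> T -> Prop) : seq T -> Prop :=
  List.ForallOrdPairs (fun x y => ~ near x y).

Definition sparse (T : Type) (near : T -> T -> Prop) (q : nat) (S : T -> Prop) : Prop :=
  forall l, List.Forall S l -> scattered near l -> size l <= q.

Section Chains.
Variables (T : Type).
Implicit Types (P : T -> Prop) (L : T -> T -> Prop).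

Lemma chain_ind P L (C : T -> Prop) x :
  C x -> (forall y z, chain P L x y -> C y -> P y -> P z -> L y z -> C z) ->
  forall y, chain P L x y -> C y.
Proof.
move=> Cx step y; apply: clos_refl_trans_ind_left => //.
by move=> u v xu Cu [Pu Pv uv]; exact: (step u v).
Qed.

Lemma chain_step P L x y : P x -> P y -> L x y -> chain P L x y.
Proof. by move=> *; apply: rt_step. Qed.

Lemma chain_in P L x y : P x -> chain P L x y -> P y.
Proof. by move=> Px; apply: chain_ind. Qed.

Lemma chain_sym P L x y : (forall x y, L x y -> L y x) ->
  chain P L x y -> chain P L y x.
Proof.
move=> sL; elim=> [u v [Pu Pv uv]|u|u v w _ uv _ vw].
- by apply: rt_step; split=> //; apply: sL.
- exact: rt_refl.
- exact: rt_trans vw uv.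
Qed.

Lemma chain_sub P L P' L' x y :
  (forall u v, chain P L x u -> P u -> P v -> L u v -> restr P' L' u v) ->
  chain P L x y -> chain P' L' x y.
Proof.
move=> sub; apply: chain_ind; first exact: rt_refl.
move=> u v xu cu Pu Pv uv; apply: rt_trans cu (rt_step _ _ _ _ _).
exact: sub.
Qed.

Lemma chain_in_chain P L x y : chain P L x y -> chain (chain P L x) L x y.
Proof.
apply: chain_sub => u v xu Pu Pv uv; split=> //.
by apply: rt_trans xu (rt_step _ _ _ _ _).
Qed.

Lemma scattered_sub (near near' : T -> T -> Prop) l :
  (forall x y, near x y -> near' x y) -> scattered near' l -> scattered near l.
Proof.
move=> sub; elim=> [|x {}l xl _ IH]; constructor=> //.
by apply: List.Forall_impl xl => y nxy /sub.
Qed.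

Lemma sparse_sub (near near' : T -> T -> Prop) q (S S' : T -> Prop) :
  (forall x y, near x y -> near' x y) -> (forall x, S' x -> S x) ->
  sparse near q S -> sparse near' q S'.
Proof.
move=> sn sS sp l lS' ln; apply: sp; last exact: scattered_sub ln.
exact: List.Forall_impl lS'.
Qed.

Lemma sparse_map (T' : Type) (near1 : T -> T -> Prop) (near2 : T' -> T' -> Prop)
    (rho : T -> T' -> Prop) K (S1 : T -> Prop) (S2 : T' -> Prop) :
  (forall x, S1 x -> exists2 y, S2 y & rho x y) ->
  (forall x x' y y', rho x y -> rho x' y' -> near2 y y' -> near1 x x') ->
  sparse near2 K S2 -> sparse near1 K S1.
Proof.
move=> S12 rho12 sp l lS1 scat.
suff [l' [sz lS2 sl _]] : exists l', [/\ size l' = size l, List.Forall S2 l',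
    scattered near2 l' & List.Forall2 rho l l'].
  by rewrite -sz; apply: sp.
elim: l lS1 scat => [_ _|x l IH]; first by exists [::]; split=> //; constructor.
move=> /List.Forall_cons_iff[/S12[y Sy xy] lS1] H.
inversion H as [|? ? xl sl]; subst.
have [l' [sz lS2 sl' ll]] := IH lS1 sl.
exists (y :: l'); split; [by rewrite /= sz|by constructor| |by constructor].
constructor=> //; elim: ll xl => [|a b l1 l2 ab _ IHl]; first by constructor.
move=> /List.Forall_cons_iff[xa xl1]; constructor; last exact: IHl.
by move=> yb; apply/xa/(rho12 x a y b).
Qed.

End Chains.

Section Nearness.
Variables (T : Type) (near : nat -> T -> T -> Prop) (nearP : nearness near).

Lemma sparse_image c m K (S S' : T -> Prop) :
  (forall x, S' x -> exists2 y, S y & near c y x) ->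
  sparse (near m) K S -> sparse (near (c + m + c)) K S'.
Proof.
move=> SS'; apply: sparse_map SS' _ => x x' y y' yx yx' yy'.
exact: (near_trans nearP) (near_trans nearP (near_sym nearP yx) yy') yx'.
Qed.

(* Walking along the chain, the points where the distance to its origin first
   exceeds successive multiples of [2 * l + D + m] are far apart from each
   other, and so are the points of [Y] next to them. *)
Lemma sparse_chain m l D K (Y P : T -> Prop) :
  (forall x, P x -> exists2 y, Y y & near l y x) ->
  sparse (near D) K Y ->
  bounded_chains near P (near m) (K * (l + l + D + m)).
Proof.
move=> PY sp z x Pz zx; set t := l + l + D + m.
suff main h : ~ near (h * t) z x -> exists s, [/\ size s = h.+1,
    List.Forall Y s, scattered (near D) s &
    List.Forall (fun y => near (h * t + m + l) z y) s].
  apply: contrapT => /main[s [sz sY ss _]].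
  by have := sp _ sY ss; rewrite sz ltnn.
elim: h => [_|h IH far].
  have [y Yy yz] := PY _ Pz; exists [:: y]; split=> //.
  - by constructor.
  - by constructor; constructor.
  - constructor=> //; apply: near_le (near_sym nearP yz) => //; lia.
have [s [sz sY ss sz']] : exists s, [/\ size s = h.+1,
    List.Forall Y s, scattered (near D) s &
    List.Forall (fun y => near (h * t + m + l) z y) s].
  by apply: IH => nzx; apply: far; apply: near_le nzx => //; lia.
have [v [Pv farv nearv]] : exists v,
    [/\ P v, ~ near (h.+1 * t) z v & near (h.+1 * t + m) z v].
  suff: near (h.+1 * t) z x \/ exists v,
      [/\ P v, ~ near (h.+1 * t) z v & near (h.+1 * t + m) z v].
    by case.
  move: x zx {IH far}; apply: chain_ind; first by left; apply: near_refl.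
  move=> u v _ [zu|?] Pu Pv uv; last by right.
  have [zv|zv] := pselect (near (h.+1 * t) z v); [by left|right].
  by exists v; split=> //; apply: (near_trans nearP) uv.
have [y Yy yv] := PY _ Pv; exists (y :: s); split.
- by rewrite /= sz.
- by constructor.
- constructor=> //; apply: List.Forall_impl sz' => w zw yw; apply: farv.
  have := near_trans nearP zw (near_trans nearP (near_sym nearP yw) yv).
  by apply: near_le => //; lia.
- constructor; last by apply: List.Forall_impl sz' => w; apply: near_le => //; lia.
  exact: (near_trans nearP) nearv (near_sym nearP yv).
Qed.

End Nearness.

(** * Colouring tree-decompositions *)

(* An abstract rooted tree-decomposition: the nodes are the pairs [(j, w)], up to
   the equivalence [E j] on [w], the ancestors of [(j, w)] are the [(i, w)] with
   [j <= i], and [bag j w] is the bag of [(j, w)]; [(k u, u)] is the topmost node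
   whose bag contains [u]. *)
Record tree_structure (T : Type) (k : T -> nat) (E : nat -> T -> T -> Prop)
    (bag : nat -> T -> T -> Prop) : Prop := TreeStructure {
  node_refl : forall j x, E j x x;
  node_sym : forall j x y, E j x y -> E j y x;
  node_trans : forall j x y z, E j x y -> E j y z -> E j x z;
  node_le : forall i j x y, i <= j -> E i x y -> E j x y;
  bag_node : forall j w w' u, E j w w' -> bag j w u -> bag j w' u;
  bag_up : forall i j w u, bag i w u -> i <= j -> j <= k u -> bag j w u;
  bag_level : forall j w u, bag j w u -> j <= k u;
  bag_top : forall j w u, bag j w u -> E (k u) w u
}.

(** Call portals of [v] the points of its top bag close to [F]; [q] bounds their packing number. The
    first component is the radius meant by close, the second bounds the monochromatic chains. [D0]
    bounds a piece near the start of a stage, and bypassing it costs the coarser scale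
    [m + D0 + m]. *)
Fixpoint tree_bounds (K q m : nat) : nat * nat :=
  if q is q'.+1 then
    let D0 := K * (m + m + m + m) in
    let b := tree_bounds K q' (m + D0 + m) in
    let L := b.1 + m + m + m + b.2 in
    (m + b.1, K * (L + L + m + m) + b.2 + (D0 + m + (b.2 + m + D0)))
  else (0, 0).

Section TreeColoring.
Variables (T : Type) (near : nat -> T -> T -> Prop) (nearP : nearness near).
Variables (J : nat) (k : T -> nat) (E bag : nat -> T -> T -> Prop).
Hypothesis treeP : tree_structure k E bag.
Hypothesis kJ : forall u, k u <= J.
Variable K : nat.

Definition bag_link m u v := near m u v /\ exists j w, bag j w u /\ bag j w v.

Lemma bag_link_sym m u v : bag_link m u v -> bag_link m v u.
Proof. by move=> [uv [j [w [? ?]]]]; split; [exact: (near_sym nearP)|exists j, w]. Qed.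

Lemma bag_link_le m m' u v : m <= m' -> bag_link m u v -> bag_link m' u v.
Proof. by move=> mm [uv b]; split=> //; apply: (near_le nearP) uv. Qed.

Section Stages.
Variables (F : T -> Prop) (m : nat).
Hypothesis F_top : forall v, F v -> bag (k v) v v.

Definition near_bag n j w v := exists y, [/\ F y, bag j w y & near n y v].

(* [stage j w] is the level of the last ancestor of [(j, w)] at which a new stage
   starts: a node starts a new stage when its bag is far from [F] inside the bag
   at which the stage of its parent started. *)
Fixpoint stage_rec i w : nat :=
  if i is i'.+1 then
    if `[< exists u, bag (J - i) w u /\ near_bag m (stage_rec i' w) w u >]
    then stage_rec i' w else J - i
  else J.

Definition stage j w := stage_rec (J - j) w.

Lemma stageJ w : stage J w = J.
Proof. by rewrite /stage subnn. Qed.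

Lemma stageS j w : j < J -> stage j w =
  if `[< exists u, bag j w u /\ near_bag m (stage j.+1 w) w u >]
  then stage j.+1 w else j.
Proof.
move=> jJ; rewrite /stage; have -> : J - j = (J - j.+1).+1 by lia.
by rewrite /=; have -> : J - (J - j.+1).+1 = j by lia.
Qed.

Lemma downward_ind (P : nat -> Prop) :
  P J -> (forall j, j < J -> P j.+1 -> P j) -> forall j, j <= J -> P j.
Proof.
move=> PJ step j jJ; rewrite -(subKn jJ); elim: (J - j) (leq_subr j J) => [|i IH] iJ.
  by rewrite subn0.
apply: step; first lia.
by rewrite subnSK //; apply: IH; apply: ltnW.
Qed.

Lemma near_bag_node n j w w' v : E j w w' -> near_bag n j w v -> near_bag n j w' v.
Proof. by move=> ww [y [Fy yw yv]]; exists y; split=> //; apply: (bag_node treeP) yw. Qed.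

Lemma near_bag_le n n' j w v : n <= n' -> near_bag n j w v -> near_bag n' j w v.
Proof. by move=> nn [y [Fy yw yv]]; exists y; split=> //; apply: (near_le nearP) yv. Qed.

Lemma near_bag_near n n' j w u v :
  near_bag n j w u -> near n' u v -> near_bag (n + n') j w v.
Proof. by move=> [y [Fy yw yu]] uv; exists y; split=> //; apply: (near_trans nearP) uv. Qed.

Lemma stage_bounds j w : j <= J -> j <= stage j w <= J.
Proof.
move: j; apply: downward_ind => [|j jJ IH]; first by rewrite stageJ leqnn.
by rewrite (stageS w jJ); case: ifP => _; lia.
Qed.

Lemma stage_node j w w' : j <= J -> E j w w' -> stage j w = stage j w'.
Proof.
move=> jJ; elim/downward_ind: j / jJ => [_|j jJ IH ww]; first by rewrite !stageJ.
have ww1 : E j.+1 w w' by apply: (node_le treeP) ww.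
have := IH ww1; have /andP[js _] := stage_bounds w jJ.
rewrite (stageS w jJ) (stageS w' jJ) => <-; congr (if _ then _ else _).
have wws : E (stage j.+1 w) w w' by apply: (node_le treeP) ww; lia.
apply: asbool_equiv_eq; split=> -[u [bu nu]]; exists u; split.
- exact: (bag_node treeP) bu.
- exact: near_bag_node nu.
- exact: (bag_node treeP) (node_sym treeP ww) bu.
- exact: near_bag_node (node_sym treeP wws) nu.
Qed.

Lemma stage_le i j w : i <= j -> j <= J -> stage i w = stage j w \/ stage i w < j.
Proof.
move=> ij jJ; have iJ : i <= J by lia.
elim/downward_ind: i / iJ ij => [|i iJ IH] ij; first by left; congr stage; lia.
have [->|ij'] := eqVneq i j; first by left.
have := IH _; rewrite (stageS w iJ); case: ifP => _; last by right; lia.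
by apply; lia.
Qed.

Lemma stage_stage j w : j <= J -> stage (stage j w) w = stage j w.
Proof.
move: j; apply: downward_ind => [|j jJ IH]; first by rewrite !stageJ.
by rewrite (stageS w jJ); case: ifPn => // h; rewrite (stageS w jJ) (negbTE h).
Qed.

Lemma stage_start a w u : a < J -> stage a w = a -> bag a w u ->
  ~ near_bag m (stage a.+1 w) w u.
Proof.
move=> aJ; rewrite (stageS w aJ); case: ifP => [_|/asboolPn h _ bu nu].
  by have := stage_bounds w aJ; lia.
by apply: h; exists u.
Qed.

Lemma stage_continued j w : j < J -> stage j w <> j ->
  exists u, bag j w u /\ near_bag m (stage j w) w u.
Proof. by move=> jJ; rewrite (stageS w jJ); case: ifP => [/asboolP|]. Qed.

Definition top_stage v := stage (k v) v.

Lemma top_stage_bounds v : k v <= top_stage v <= J.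
Proof. exact: stage_bounds. Qed.

(** A stage is identified by the node where it starts: a level and a class of [E] at that level. *)
Definition same_stage u v := top_stage u = top_stage v /\ E (top_stage u) u v.

Lemma same_stage_refl u : same_stage u u.
Proof. by split=> //; apply: (node_refl treeP). Qed.

Lemma same_stage_sym u v : same_stage u v -> same_stage v u.
Proof. by move=> [uv Euv]; split=> //; rewrite -uv; apply: (node_sym treeP) Euv. Qed.

Lemma same_stage_trans u v w : same_stage u v -> same_stage v w -> same_stage u w.
Proof.
move=> [uv Euv] [vw Evw]; split; first by rewrite uv.
by apply: (node_trans treeP) Euv _; rewrite uv.
Qed.

Definition near_start n u v := near_bag n (top_stage u) u v.

Lemma near_start_same n u v x : same_stage u v -> near_start n u x -> near_start n v x.
Proof. by move=> [uv Euv]; rewrite /near_start -uv; apply: near_bag_node. Qed.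

Definition child_link u v :=
  [/\ F u, bag (top_stage v) v u, ~ near_start m u u,
      top_stage u = stage (top_stage v).+1 v & E (top_stage u) u v].

Lemma child_link_near n u v : near n u v -> child_link u v -> near_start n v v.
Proof. by move=> uv [Fu bu _ _ _]; exists u. Qed.


Lemma child_link_same u u' v v' : child_link u v -> child_link u' v' ->
  same_stage v v' -> same_stage u u' /\ exists j w, bag j w u /\ bag j w u'.
Proof.
move=> [Fu bu nu su Eu] [Fu' bu' nu' su' Eu'] [vv' Ev]; rewrite -vv' in bu' su'.
(* A stage starting at level [J] has no parent: [u] would lie in the start bag of its own stage. *)
have vJ : top_stage v < J.
  have vs := top_stage_bounds v; rewrite ltn_neqAle; case: eqP => [e|_]; last by lia.
  have uJ : k u = J by have := bag_level treeP bu; have := kJ u; lia.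
  case: nu; rewrite /near_start /top_stage uJ stageJ; exists u; split=> //.
    by rewrite -uJ; exact: F_top.
  exact: (near_refl nearP).
have Ev1 := node_le treeP (leqnSn _) Ev.
have uu' : top_stage u = top_stage u' by rewrite su su' (stage_node _ Ev1).
split; last first.
  by exists (top_stage v), v; split=> //; apply: (bag_node treeP) bu'; apply: (node_sym treeP).
split=> //; apply: (node_trans treeP) Eu _.
have vu : top_stage v <= top_stage u.
  by rewrite su; have := stage_bounds v vJ; lia.
apply: (node_trans treeP) (node_le treeP vu Ev) _.
by apply: (node_sym treeP); rewrite uu'.
Qed.

(** Linked points share a bag, so their top nodes lie on one branch. If the stages differ, the upper
    point is in the start bag of the lower stage; a stage in between would have that point in its
    start bag too, and then the lower stage could not start at a bag containing it. *)
Lemma link_stages u v : F u -> F v -> bag_link m u v ->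
  [\/ same_stage u v, child_link u v | child_link v u].
Proof.
wlog kuv : u v / k v <= k u => [hw Fu Fv uv|].
  have /orP[vu|uv'] := leq_total (k v) (k u); first exact: hw.
  by case: (hw v u uv' Fv Fu (bag_link_sym uv)) => h;
    [apply: Or31; apply: same_stage_sym|apply: Or33|apply: Or32].
move=> Fu Fv [nuv [j [w [bu bv]]]].
have Eu := bag_top treeP bu; have Ev := bag_top treeP bv.
have su : top_stage u = stage (k u) w by rewrite (stage_node (kJ u) Eu).
have sv : top_stage v = stage (k v) w by rewrite (stage_node (kJ v) Ev).
have /andP[kv _] := top_stage_bounds v; have /andP[ku _] := top_stage_bounds u.
have [e|lt] := stage_le w kuv (kJ u).
  apply: Or31; split; first by rewrite su sv.
  apply: (node_trans treeP (y := w)); first exact: (node_sym treeP) (node_le treeP ku Eu).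
  by apply: (node_le treeP) Ev; lia.
apply: Or32; have aE := node_le treeP kv Ev.
have bau : bag (top_stage v) w u.
  by apply: (bag_up treeP) bu _ _ => //; [have := bag_level treeP bv|rewrite sv]; lia.
have aJ : top_stage v < J by rewrite sv; have := kJ u; lia.
have e : stage (top_stage v).+1 w = top_stage u.
  have [||->//|lt'] := @stage_le (top_stage v).+1 (k u) w; rewrite ?sv //.
  exfalso; apply: (@stage_start (top_stage v) w u) => //.
    by rewrite sv stage_stage.
  exists u; split=> //; last exact: (near_refl nearP).
  apply: (bag_up treeP) bau _ (ltnW lt').
  by have := stage_bounds w aJ; lia.
have Euw : E (top_stage u) w u by apply: (node_le treeP) Eu.
have Ew : E (top_stage u) w v.
  by apply: (node_le treeP) aE; rewrite sv; lia.
split=> //.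
- exact: (bag_node treeP) bau.
- move=> /near_bag_node h; have := h _ (node_sym treeP Euw).
  rewrite -e; apply: (stage_start aJ _ bau).
  by rewrite sv stage_stage.
- rewrite -e; apply: stage_node => //.
  by apply: (node_le treeP) aE.
- exact: (node_trans treeP) (node_sym treeP Euw) Ew.
Qed.

Section Step.
Variables q sg D : nat.
Let D0 := K * (m + m + m + m).
Let m' := m + D0 + m.
Let far := sg + m + m.

Hypothesis bag_sparse : forall j w, sparse (near m) K (bag j w).
Hypothesis F_sparse : forall v, F v -> sparse (near m) q.+1
  (fun u => bag (k v) v u /\ exists f, F f /\ near (m + sg) f u).
Hypothesis IH : forall F' : T -> Prop, (forall v, F' v -> F v) ->
  (forall v, F' v -> sparse (near m') q
    (fun u => bag (k v) v u /\ exists f, F' f /\ near sg f u)) ->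
  exists chi : T -> bool, forall b,
    bounded_chains near (fun v => F' v /\ chi v = b) (bag_link m') D.

Definition rest v u := [/\ F u, same_stage v u & ~ near_start far v u].

Lemma rest_same v v' : same_stage v v' -> rest v = rest v'.
Proof.
move=> vv'; apply/funext => u; apply/propext; split=> -[Fu vu nu]; split=> //.
- exact: same_stage_trans (same_stage_sym vv') vu.
- by move=> /(near_start_same (same_stage_sym vv')).
- exact: same_stage_trans vv' vu.
- by move=> /(near_start_same vv').
Qed.

(* The bag at [v] contains a point close to the start of the stage of [v], which
   is far from [rest v]: one portal fewer is left. *)
Lemma rest_sparse v0 v : rest v0 v -> sparse (near m') q
  (fun u => bag (k v) v u /\ exists f, rest v0 f /\ near sg f u).
Proof.
move=> [Fv v0v nv] l lS lm'.
have nv' : ~ near_start far v v by move=> /(near_start_same (same_stage_sym v0v)).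
have kv : top_stage v <> k v.
  move=> e; apply: nv'; rewrite /near_start e; exists v.
  by split=> //; [apply: F_top|apply: near_refl].
have kJ' : k v < J.
  by have := top_stage_bounds v; have := kJ v; lia.
have [y [by_ [y0 [Fy0 by0 y0y]]]] := stage_continued kJ' kv.
have /F_sparse/(_ (y :: l)) := Fv; apply.
- constructor.
    by split=> //; exists y0; split=> //; apply: (near_le nearP) y0y; lia.
  apply: List.Forall_impl lS => u [bu [f [[Ff _ _] fu]]]; split=> //.
  by exists f; split=> //; apply: (near_le nearP) fu; lia.
- constructor; last first.
    by apply: scattered_sub lm' => a b; apply: (near_le nearP); rewrite /m'; lia.
  apply: List.Forall_impl lS => u [bu [f [[Ff v0f nf] fu]]] yu; apply: nf.
  apply: near_start_same (same_stage_sym v0v) _; exists y0; split=> //.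
  have := near_trans nearP y0y (near_trans nearP yu (near_sym nearP fu)).
  by apply: (near_le nearP); rewrite /far; lia.
Qed.

(** The colouring is indexed by the set [rest v] and not by [v], so that all points of one stage
    share it. *)
Lemma rest_coloring : exists chi : (T -> Prop) -> T -> bool, forall v b,
  bounded_chains near (fun u => rest v u /\ chi (rest v) u = b) (bag_link m') D.
Proof.
have /choice[chi chiP] (S : T -> Prop) : exists chi : T -> bool,
    forall v, S = rest v -> forall b,
    bounded_chains near (fun u => rest v u /\ chi u = b) (bag_link m') D.
  have [[v ->]|nS] := pselect (exists v, S = rest v); last first.
    by exists (fun=> true) => v Sv; case: nS; exists v.
  have [||chi chiP] := IH (F' := rest v); first by move=> u [].
    exact: rest_sparse.
  by exists chi => v' <-.
by exists chi => v; apply: chiP.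
Qed.

Section Color.
Variable chi : (T -> Prop) -> T -> bool.
Hypothesis chiP : forall v b,
  bounded_chains near (fun u => rest v u /\ chi (rest v) u = b) (bag_link m') D.

(** The points near the start of their stage get [true], a ring around them [false], and the
    induction colours the rest. The ring is wide enough that no link joins the two kinds of [true]
    points within a stage. *)
Definition color v :=
  if `[< near_start m v v >] then true
  else if `[< near_start far v v >] then false else chi (rest v) v.

Lemma color_trueP v : F v -> color v = true ->
  near_start m v v \/ rest v v /\ chi (rest v) v = true.
Proof.
rewrite /color; case: asboolP => [|_ Fv]; first by left.
case: asboolP => // nv chiv; right; split=> //; split=> //.
exact: same_stage_refl.
Qed.

Lemma color_falseP v : F v -> color v = false -> ~ near_start m v v /\
  (near_start far v v \/ rest v v /\ chi (rest v) v = false).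
Proof.
rewrite /color; case: asboolP => // nv Fv; case: asboolP => [nv' _|nv' chiv].
  by split=> //; left.
split=> //; right; split=> //; split=> //; exact: same_stage_refl.
Qed.

Lemma rest_trans v u : same_stage v u -> rest u u -> rest v u.
Proof. by move=> /rest_same ->. Qed.

Lemma link_mm' u v : bag_link m u v -> bag_link m' u v.
Proof. by apply: bag_link_le; rewrite /m'; lia. Qed.

Lemma near_start_far v u : near_start m v u -> near_start far v u.
Proof. by apply: near_bag_le; rewrite /far; lia. Qed.

Lemma start_sparse v : sparse (near m) K (fun y => F y /\ bag (top_stage v) v y).
Proof. by apply: (sparse_sub _ _ (@bag_sparse (top_stage v) v)) => // y []. Qed.

(** A link between two stages ends near the start of the lower one, at a point coloured [true]; so a
    [false] chain stays in one stage. If it meets the ring, it stays within [L] of the start bag,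
    which is sparse; otherwise it stays in [rest]. *)
Lemma color_false_bounded : bounded_chains near (fun v => F v /\ color v = false)
  (bag_link m) (K * ((far + m + D) + (far + m + D) + m + m) + D).
Proof.
set P := fun v => _; set L := far + m + D.
have same u v : P u -> P v -> bag_link m u v -> same_stage u v.
  move=> [Fu cu] [Fv cv] uv.
  have [nu _] := color_falseP Fu cu; have [nv _] := color_falseP Fv cv.
  have [//|/child_link_near h|/child_link_near h] := link_stages Fu Fv uv.
    by case: nv; apply: h; case: uv.
  by case: nu; apply: h; apply: (near_sym nearP); case: uv.
have same_chain u v : chain P (bag_link m) u v -> same_stage u v.
  move: v; apply: chain_ind; first exact: same_stage_refl.
  by move=> v w _ uv Pv Pw /(same v w Pv Pw); apply: same_stage_trans.
move=> z x Pz zx.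
have [[s [zs ns]]|no] := pselect (exists s, chain P (bag_link m) z s /\ near_start far s s);
    last first.
  have: near D z x; last by apply: (near_le nearP); lia.
  have inrest u : chain P (bag_link m) z u -> rest z u /\ chi (rest z) u = false.
    move=> zu; have [Fu cu] := chain_in Pz zu; have zu' := same_chain _ _ zu.
    have [_ [nu|[ru cru]]] := color_falseP Fu cu; first by case: no; exists u.
    by split; [apply: rest_trans|rewrite (rest_same zu')].
  apply: (chiP (v := z) (b := false)); first exact/inrest/rt_refl.
  apply: chain_sub zx => u v zu Pu Pv uv; split; [exact: inrest|apply: inrest|exact: link_mm'].
  by apply: rt_trans zu (chain_step Pu Pv uv).
have Ps := chain_in Pz zs.
have nearL u : chain P (bag_link m) s u -> near_start L s u.
  (* Each point of the chain is in the ring or is reached from a ring point [t] through [rest],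
     whence [L = far + m + D]. *)
  suff inv : chain P (bag_link m) s u -> exists t, [/\ same_stage s t, near_start far t t &
      u = t \/ exists t1, [/\ bag_link m t t1, rest t1 t1, chi (rest t1) t1 = false &
        chain (fun u => rest t1 u /\ chi (rest t1) u = false) (bag_link m') t1 u]].
    move=> /inv[t [st nt [->|[t1 [[tt1 _] rt ct t1u]]]]];
      apply: near_start_same (same_stage_sym st) _.
      by apply: near_bag_le nt; rewrite /L; lia.
    have nt1u : near D t1 u by apply: (chiP (v := t1) (b := false)).
    have := near_bag_near (near_bag_near nt tt1) nt1u.
    by apply: near_bag_le; rewrite /L; lia.
  move: u; apply: chain_ind.
    by exists s; split=> //; [apply: same_stage_refl|left].
  move=> u v su [t [st nt h]] Pu Pv uv.
  have sv : same_stage s v.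
    exact: same_stage_trans (same_chain _ _ su) (same _ _ Pu Pv uv).
  have [Fv cv] := Pv; have [_ [nv|[rv cv']]] := color_falseP Fv cv.
    by exists v; split=> //; left.
  exists t; split=> //; right; case: h => [<-|[t1 [tt1 rt1 ct1 t1u]]].
    by exists v; split=> //; apply: rt_refl.
  have t1u' : rest t1 u /\ chi (rest t1) u = false by apply: chain_in t1u.
  have t1v : same_stage t1 v.
    by apply: same_stage_trans (same _ _ Pu Pv uv); case: t1u' => -[].
  exists t1; split=> //; apply: rt_trans t1u (chain_step _ _ (link_mm' uv)) => //.
  by split; [apply: rest_trans|rewrite (rest_same t1v)].
have szs := same_chain _ _ zs.
apply: (near_le nearP (a := K * (L + L + m + m))); first by lia.
suff h : bounded_chains near (chain P (bag_link m) z) (near m) (K * (L + L + m + m)).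
  apply: h; first exact: rt_refl.
  by apply: chain_sub (chain_in_chain zx) => u v _ zu zv [uv _].
apply: (sparse_chain nearP _ (@start_sparse z)) => u zu.
have su : chain P (bag_link m) s u.
  by apply: rt_trans zu; apply: chain_sym zs; exact: bag_link_sym.
by have [y [Fy yb yu]] := near_start_same (same_stage_sym szs) (nearL u su); exists y.
Qed.

Lemma color_true_bounded : bounded_chains near (fun v => F v /\ color v = true)
  (bag_link m) (D0 + m + (D + m + D0)).
Proof.
set P := fun v => _.
(* [P1] is the part near the starts, [P2] the part in [rest]. Links inside [P1] or inside [P2] keep
   the stage; a link between [P2] and [P1] goes from a stage down to a child stage. *)
pose P1 v := F v /\ near_start m v v.
pose P2 v := [/\ F v, rest v v & chi (rest v) v = true].
have P12 v : P v -> P1 v \/ P2 v.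
  by move=> [Fv cv]; have [nv|[rv cv']] := color_trueP Fv cv; [left|right].
have P2n v : P2 v -> ~ near_start far v v by move=> [_ []].
have same11 u v : P1 u -> P1 v -> bag_link m u v -> same_stage u v.
  move=> [Fu nu] [Fv nv] uv; have [//|[]//|[]//] := link_stages Fu Fv uv.
have same22 u v : P2 u -> P2 v -> bag_link m u v -> same_stage u v.
  move=> Pu Pv uv; have [Fu _ _] := Pu; have [Fv _ _] := Pv.
  have [//|/child_link_near h|/child_link_near h] := link_stages Fu Fv uv.
    by case: (P2n v) => //; apply/near_start_far/h; case: uv.
  by case: (P2n u) => //; apply/near_start_far/h/(near_sym nearP); case: uv.
have child u v : P2 u -> P1 v -> bag_link m u v -> child_link u v.
  move=> Pu [Fv nv] uv; have [Fu _ _] := Pu; have [vu _] := bag_link_sym uv.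
  have [uv'|//|/child_link_near h] := link_stages Fu Fv uv; case: (P2n u) => //.
    have /near_bag_near/(_ vu) := near_start_same (same_stage_sym uv') nv.
    by apply: near_bag_le; rewrite /far; lia.
  exact/near_start_far/h.
have same1 u v : P1 u -> chain P1 (bag_link m) u v -> same_stage u v.
  move=> _; move: v; apply: chain_ind; first exact: same_stage_refl.
  by move=> v w _ uv Pv Pw /(same11 v w Pv Pw); apply: same_stage_trans.
have near1 u v : P1 u -> chain P1 (bag_link m) u v -> near D0 u v.
  move=> Pu uv.
  suff h : bounded_chains near (chain P1 (bag_link m) u) (near m) D0.
    apply: h; first exact: rt_refl.
    by apply: chain_sub (chain_in_chain uv) => w w' _ uw uw' [ww' _].
  apply: (sparse_chain nearP _ (@start_sparse u)) => w uw.
  have [Fw nw] := chain_in Pu uw.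
  by have [y [Fy yb yw]] := near_start_same (same_stage_sym (same1 _ _ Pu uw)) nw; exists y.
(* A piece [y -- x] close to the start of a stage is linked only to elements of
   the parent stage, all in the same bag and at distance at most [m'] from each
   other; so it can be bypassed by a link of length [m']. *)
have inv z x : P2 z -> chain P (bag_link m) z x -> exists x0,
    chain (fun u => rest z u /\ chi (rest z) u = true) (bag_link m') z x0 /\
    (x = x0 \/ exists y, [/\ P1 y, bag_link m x0 y & chain P1 (bag_link m) y x]).
  move=> Pz; have in2 u : same_stage z u -> P2 u -> rest z u /\ chi (rest z) u = true.
    by move=> zu [Fu ru cu]; split; [apply: rest_trans|rewrite (rest_same zu)].
  have z2 : rest z z /\ chi (rest z) z = true by case: Pz.
  move: x; apply: chain_ind.
    by exists z; split; [apply: rt_refl|left].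
  move=> u v zu [x0 [zx0 h]] Pu Pv uv.
  have [rx0 cx0] := chain_in z2 zx0; have [Fx0 zx0' _] := rx0.
  have P2x0 : P2 x0 by split=> //; rewrite -(rest_same zx0').
  have [P1v|P2v] := P12 _ Pv.
    exists x0; split=> //; right; case: h => [e|[y [P1y x0y yu]]].
      by exists v; split; [|rewrite -e|apply: rt_refl].
    have P1u : P1 u := chain_in P1y yu.
    by exists y; split=> //; apply: rt_trans yu (chain_step P1u P1v uv).
  exists v; split; last by left.
  case: h => [e|[y [P1y x0y yu]]].
    rewrite e in uv; have := same22 _ _ P2x0 P2v uv => x0v.
    apply: rt_trans zx0 (chain_step _ _ (link_mm' uv)) => //.
    by apply: in2 => //; apply: same_stage_trans x0v.
  have P1u : P1 u := chain_in P1y yu.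
  have [x0v b] := child_link_same (child _ _ P2x0 P1y x0y)
    (child _ _ P2v P1u (bag_link_sym uv)) (same1 _ _ P1y yu).
  apply: rt_trans zx0 (chain_step (conj rx0 cx0) _ _).
    by apply: in2 => //; apply: same_stage_trans x0v.
  split=> //; case: x0y => x0y _; case: uv => uv _.
  exact: (near_trans nearP) (near_trans nearP x0y (near1 _ _ P1y yu)) uv.
have near2 z x : P2 z -> chain P (bag_link m) z x -> near (D + m + D0) z x.
  move=> Pz /(inv _ _ Pz)[x0 [zx0 h]].
  have zx0' : near D z x0 by apply: (chiP (v := z) (b := true)) zx0; case: Pz.
  case: h => [->|[y [P1y [x0y _] yx]]]; first by apply: (near_le nearP) zx0'; lia.
  exact: (near_trans nearP) (near_trans nearP zx0' x0y) (near1 _ _ P1y yx).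
move=> z x Pz zx; have [P1z|P2z] := P12 _ Pz; last first.
  by apply: (near_le nearP) (near2 _ _ P2z zx); lia.
(* The chain is cut where it first enters [P2]; [near1] bounds what precedes and [near2] what
   follows. *)
suff [zx1|[y [w [zy [yw _] P2w wx]]]] : chain P1 (bag_link m) z x \/
    exists y w, [/\ chain P1 (bag_link m) z y, bag_link m y w, P2 w & chain P (bag_link m) w x].
- by apply: (near_le nearP) (near1 _ _ P1z zx1); lia.
- exact: (near_trans nearP) (near_trans nearP (near1 _ _ P1z zy) yw) (near2 _ _ P2w wx).
move: x zx; apply: chain_ind; first by left; apply: rt_refl.
move=> u v zu h Pu Pv uv; case: h => [zu1|[y [w [zy yw P2w wx]]]]; last first.
  by right; exists y, w; split=> //; apply: rt_trans wx (chain_step Pu Pv uv).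
have [P1v|P2v] := P12 _ Pv.
  by left; apply: rt_trans zu1 (chain_step (chain_in P1z zu1) P1v uv).
by right; exists u, v; split=> //; apply: rt_refl.
Qed.

End Color.
End Step.
End Stages.

(** Induction on [q], each step losing one portal at the price of a coarser scale; [K] is kept,
    since a packing bound persists at coarser scales. *)
Theorem tree_coloring q m (F : T -> Prop) :
  (forall j w, sparse (near m) K (bag j w)) ->
  (forall v, F v -> bag (k v) v v) ->
  (forall v, F v -> sparse (near m) q (fun u => bag (k v) v u /\
     exists f, F f /\ near (tree_bounds K q m).1 f u)) ->
  exists chi : T -> bool, forall b,
    bounded_chains near (fun v => F v /\ chi v = b) (bag_link m) (tree_bounds K q m).2.
Proof.
elim: q m F => [|q IH] m F bsp Ftop Fsp.
  (* A point of [F] is one of its own portals, so [F] is empty when [q] is 0. *)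
  exists (fun=> true) => b v x [Fv _]; have := Fsp v Fv [:: v].
  rewrite ltnn => h; suff: False by []; apply: notF; apply: h.
    constructor=> //; split; first exact: Ftop.
    by exists v; split=> //; apply: near_refl.
  by constructor; constructor.
set b := tree_bounds K q (m + K * (m + m + m + m) + m).
have rIH (F' : T -> Prop) : (forall v, F' v -> F v) ->
    (forall v, F' v -> sparse (near (m + K * (m + m + m + m) + m)) q
      (fun u => bag (k v) v u /\ exists f, F' f /\ near b.1 f u)) ->
    exists chi : T -> bool, forall c, bounded_chains near
      (fun v => F' v /\ chi v = c) (bag_link (m + K * (m + m + m + m) + m)) b.2.
  move=> F'F F'sp; apply: IH => // [j w|v /F'F]; last exact: Ftop.
  apply: sparse_sub (bsp j w) => // x y; apply: (near_le nearP); lia.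
have [chi chiP] := rest_coloring Ftop Fsp rIH.
exists (color F m b.1 chi) => -[].
- move=> x y Fx xy; have h := color_true_bounded Ftop bsp chiP Fx xy.
  by apply: (near_le nearP) h; apply: leq_addl.
- move=> x y Fx xy; have h := color_false_bounded bsp chiP Fx xy.
  by apply: (near_le nearP) h; apply: leq_addr.
Qed.

End TreeColoring.

(** * Layered colourings *)

(** [M1] bounds the contracted pieces, and moving to representatives costs [M1] at both ends. The
    scale [M1 + m0 + M1 + s] serves both for the packing bound of the bags and for the length of the
    links. *)
Definition absorb_bound (K m0 s M : nat) : nat :=
  let M1 := s + M + s in M1 + (tree_bounds K K (M1 + m0 + M1 + s)).2 + M1.

Section Absorption.
Variables (T : choiceType) (near : nat -> T -> T -> Prop) (nearP : nearness near).
Variables (J : nat) (k : T -> nat) (E : nat -> T -> T -> Prop) (A : T -> Prop).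
Variables (s m0 K M : nat) (W : T -> Prop).
Hypothesis kJ : forall u, k u <= J.
Hypothesis E_refl : forall j x, E j x x.
Hypothesis E_sym : forall j x y, E j x y -> E j y x.
Hypothesis E_trans : forall j x y z, E j x y -> E j y z -> E j x z.
Hypothesis E_le : forall i j x y, i <= j -> E i x y -> E j x y.
Hypothesis E_near : forall j u v, A u -> A v -> near s u v -> k u <= j -> E j u v.

(* The bag at the node [(j, w)] of a tree-decomposition of the graph of the pairs
   at distance at most [s] in [A]. *)
Definition crossing j w u := [/\ A u, j <= k u &
  exists x, [/\ A x, k x <= j, E j w x & near s x u]].

Hypothesis crossing_sparse : forall j w, sparse (near m0) K (crossing j w).
Hypothesis W_bounded : bounded_chains near W (near (s + s + s)) M.

Let Q u := A u /\ exists2 o, W o & near s o u.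
Let cl := chain Q (near s).
Let M1 := s + M + s.

Let cl_sym u v : cl u v -> cl v u.
Proof. by apply: chain_sym => x y; apply: (near_sym nearP). Qed.

Let cl_A u v : A u -> cl u v -> A v.
Proof.
move=> Au; apply: (@chain_ind _ _ _ A) => //.
by move=> y z _ _ _ [].
Qed.

(** The points of [W] next to consecutive points of the chain are within [s + s + s] of each other,
    so they form a chain in [W]. *)
Let cl_near u v : cl u v -> near M1 u v.
Proof.
have [Qu|nQ] := pselect (Q u); last first.
  move=> uv; suff -> : v = u by apply: (near_refl nearP).
  by move: v uv; apply: chain_ind => // v w _ ->.
have [_ [o Wo ou]] := Qu.
move=> uv; suff [o' [Wo' o'v oo']] : exists o', [/\ W o', near s o' v &
    chain W (near (s + s + s)) o o'].
  exact: (near_trans nearP) (near_trans nearP (near_sym nearP ou) (W_bounded Wo oo')) o'v.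
move: v uv; apply: chain_ind; first by exists o; split=> //; apply: rt_refl.
move=> v w _ [o' [Wo' o'v oo']] _ [_ [p Wp pw]] vw; exists p; split=> //.
apply: rt_trans oo' (chain_step Wo' Wp _).
exact: (near_trans nearP) (near_trans nearP o'v vw) (near_sym nearP pw).
Qed.

Let cl_ex u : exists v, `[< cl u v >].
Proof. by exists u; apply/asboolP/rt_refl. Qed.

Let rep u := xchoose (cl_ex u).

Let cl_rep u : cl u (rep u).
Proof. exact/asboolP/(xchooseP (cl_ex u)). Qed.

Let rep_eq u v : cl u v -> rep u = rep v.
Proof.
move=> uv; apply: eq_xchoose => w; apply: asbool_equiv_eq; split=> h.
  by apply: rt_trans h; apply: cl_sym.
exact: rt_trans uv h.
Qed.

Let top_ex a : exists n, (exists u, cl a u /\ k u = n) /\ forall u, cl a u -> k u <= n.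
Proof.
pose P n := `[< exists u, cl a u /\ k u = n >].
have exP : exists n, P n by exists (k a); apply/asboolP; exists a; split=> //; apply: rt_refl.
have PJ n : P n -> n <= J by move=> /asboolP[u [_ <-]].
have := ex_maxnP exP PJ; case=> n /asboolP Pn nmax; exists n; split=> // u au.
by apply: nmax; apply/asboolP; exists u.
Qed.

Let cl_E j u v : A u -> cl u v -> (forall w, cl u w -> k w <= j) -> E j u v.
Proof.
move=> Au uv kj; move: v uv; apply: chain_ind => // x y ux Eux [Ax _] [Ay _] xy.
by apply: E_trans Eux (E_near _ _ xy _) => //; apply: kj.
Qed.

(* The pieces of the buffer [W] inside [A] are contracted, as chains of [Q], before
   [A] is 2-coloured: the colouring does not change near [W], so that the boundary
   between the two colours can be added to the buffer without joining its pieces. *)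
Lemma absorb (s' : nat) : s' + s' <= s ->
  exists W' : T -> Prop, [/\ forall u, W u -> W' u,
    bounded_chains near W' (near s') (M + absorb_bound K m0 s M) &
    bounded_chains near (fun u => A u /\ ~ W' u) (near s') (absorb_bound K m0 s M)].
Proof.
move=> ss'; rewrite /absorb_bound -/M1; set D := (tree_bounds _ _ _).2.
 have [top topP] := choice top_ex.
have top_le a u : cl a u -> k u <= top a by case: (topP a) => _; apply.
(* The contracted graph: its points are the representatives, the level of a piece is the largest one
   in it, and its bags are the images of the sets [crossing]. *)
pose F a := exists2 u, A u & rep u = a.
pose bag j w a := exists2 u, crossing j w u & rep u = a.
have rep_cl u a : rep u = a -> cl a u by move=> <-; apply/cl_sym/cl_rep.
(* Take the first point of the chain from [u] to [v] that reaches level [j]. *)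
have reach j j0 w u v : j0 <= j -> crossing j0 w u -> cl u v -> j <= k v ->
    exists2 z, crossing j w z & cl u z.
  move=> j0j [Au j0u [x [Ax xj0 wx xu]]] uv jv.
  suff [//|[vj _]] : (exists2 z, crossing j w z & cl u z) \/ k v < j /\ E j w v.
    by move: jv; rewrite leqNgt vj.
  have first y z : A y -> k y <= j -> E j w y -> A z -> near s y z -> cl u z ->
      (exists2 z, crossing j w z & cl u z) \/ k z < j /\ E j w z.
    move=> Ay yj wy Az yz uz; have [jz|zj] := leqP j (k z).
      by left; exists z => //; split=> //; exists y.
    by right; split=> //; apply: E_trans wy (E_near _ _ yz yj).
  move: v uv {jv}; apply: chain_ind.
    by apply: (first x); [|lia|apply: E_le wx| | |apply: rt_refl].
  move=> y z uy [h|[yj wy]] Qy Qz yz; first by left.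
  apply: (first y) => //; [by case: Qy|exact: ltnW|by case: Qz|].
  exact: rt_trans uy (chain_step Qy Qz yz).
have treeP : tree_structure top E bag.
  split=> //.
  - move=> j w w' a ww' [u [Au ju [x [Ax xj wx xu]]] ua]; exists u => //.
    by split=> //; exists x; split=> //; apply: E_trans (E_sym ww') wx.
  - move=> i j w a [u cu ua] ij ja; have au := rep_cl _ _ ua.
    have [[v [av vtop]] _] := topP a.
    have [||z cz uz] := reach j i w u v ij cu; rewrite ?vtop //.
      exact: rt_trans (cl_sym au) av.
    by exists z => //; rewrite -(rep_eq uz).
  - move=> j w a [u [_ ju _] ua]; apply: leq_trans ju (top_le _ _ _).
    exact: rep_cl.
  - move=> j w a [u [Au ju [x [Ax xj wx xu]]] ua]; have au := rep_cl _ _ ua.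
    have utop := top_le _ _ au.
    apply: E_trans (E_le _ wx) _; first by lia.
    apply: E_trans (E_near Ax Au xu _) _; first by lia.
    apply/E_sym/cl_E => //; [apply: cl_A Au _; exact: cl_sym|exact: top_le].
have topJ a : top a <= J by case: (topP a) => -[u [_ <-]].
have bag_sparse j w : sparse (near (M1 + m0 + M1 + s)) K (bag j w).
  apply: sparse_sub (sparse_image nearP (c := M1) (S' := bag j w) _ (@crossing_sparse j w)).
  - by move=> x y; apply: (near_le nearP); lia.
  - by [].
  - by move=> a [u cu ua]; exists u => //; apply/cl_near/cl_sym/rep_cl.
have F_top a : F a -> bag (top a) a a.
  move=> [u Au ua]; have au := rep_cl _ _ ua; have [[z [az ztop]] _] := topP a.
  have Aa : A a by apply: cl_A Au (cl_sym au).
  exists z; last by rewrite -ua; apply: rep_eq; apply: rt_trans (cl_sym az) au.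
  split; [exact: cl_A az|by rewrite ztop|exists z; split].
  - exact: cl_A az.
  - by rewrite ztop.
  - by apply: cl_E => // w; apply: top_le.
  - exact: (near_refl nearP).
(* The portals are counted with [q = K], a bound that already holds for the whole bag. *)
have [chi chiP] : exists chi : T -> bool, forall b, bounded_chains near
    (fun v => F v /\ chi v = b) (bag_link near bag (M1 + m0 + M1 + s)) D.
  apply: (tree_coloring nearP treeP topJ bag_sparse F_top) => a _.
  by apply: sparse_sub (bag_sparse (top a) a) => // u [].
pose xi u := chi (rep u).
have mono b : bounded_chains near (fun u => A u /\ xi u = b) (near s) (M1 + D + M1).
  move=> u v [Au xu] uv.
  have uru w : near M1 w (rep w) by apply: cl_near.
  apply: (near_trans nearP) (near_trans nearP (uru u) _) (near_sym nearP (uru v)).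
  apply: (chiP b); first by split=> //; exists u.
  move: v uv; apply: chain_ind; first exact: rt_refl.
  move=> v w _ cv [Av xv] [Aw xw] vw; apply: rt_trans cv (chain_step _ _ _).
  - by split=> //; exists v.
  - by split=> //; exists w.
  split.
    have := near_trans nearP (near_trans nearP (near_sym nearP (uru v)) vw) (uru w).
    by apply: (near_le nearP); lia.
  have cross x y : A x -> A y -> k x <= k y -> near s x y ->
      exists j z, bag j z (rep x) /\ bag j z (rep y).
    move=> Ax Ay xy nxy; exists (k x), x; split.
      by exists x => //; split=> //; exists x; split=> //; apply: (near_refl nearP).
    by exists y => //; split=> //; exists x; split.
  have [vw'|/ltnW wv] := leqP (k v) (k w); first exact: cross.
  by have [j [z [? ?]]] := cross _ _ Aw Av wv (near_sym nearP vw); exists j, z.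
pose B u := [/\ A u, xi u = true & exists v, [/\ A v, xi v = false & near s' u v]].
have s's x y : near s' x y -> near s x y by apply: (near_le nearP); lia.
(* If [o] were near a boundary point [u], then by [s' + s' <= s] the neighbour [v] of the other
   colour would also be within [s] of [o]. Both would be in [Q], hence in one piece and of one
   colour. *)
have WB o u : W o -> B u -> ~ near s' o u.
  move=> Wo [Au xu [v [Av xv uv]]] ou.
  have Qu : Q u by split=> //; exists o => //; apply: s's.
  have Qv : Q v.
    split=> //; exists o => //.
    by apply: (near_le nearP) (near_trans nearP ou uv).
  have := rep_eq (chain_step Qu Qv (s's _ _ uv)).
  by move: xu xv; rewrite /xi => + + e; rewrite e => ->.
exists (fun u => W u \/ B u); split; first by left.
- move=> u v [Wu|Bu] uv.
    suff uv' : chain W (near (s + s + s)) u v.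
      by apply: (near_le nearP) (W_bounded Wu uv'); lia.
    move: v uv; apply: chain_ind; first exact: rt_refl.
    move=> v w _ cv _ Ww vw; have Wv := chain_in Wu cv.
    apply: rt_trans cv (chain_step Wv _ _); last by apply: (near_le nearP) vw; lia.
    by case: Ww => // Bw; case: (WB v w).
  suff uv' : chain B (near s) u v.
    apply: (near_le nearP (a := M1 + D + M1)); first by lia.
    apply: (mono true); first by case: Bu.
    by apply: chain_sub uv' => x y _ [? ? _] [? ? _] xy; split.
  move: v uv; apply: chain_ind; first exact: rt_refl.
  move=> v w _ cv _ Bw vw; have Bv := chain_in Bu cv.
  apply: rt_trans cv (chain_step Bv _ _); last exact: s's.
  by case: Bw => // Ww; case: (WB w v) => //; apply: (near_sym nearP).
- move=> u v [Au nu] uv; apply: (mono (xi u)) => //.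
  move: v uv; apply: chain_ind; first exact: rt_refl.
  move=> v w _ cv [Av nv] [Aw nw] vw.
  have [_ xv] : A v /\ xi v = xi u by apply: chain_in cv.
  apply: rt_trans cv (chain_step _ _ (s's _ _ vw)) => //; split=> //.
  rewrite -xv; case ev : (xi v); case ew : (xi w) => //.
    by case: nv; right; split=> //; exists w.
  by case: nw; right; split=> //; exists v; split=> //; apply: (near_sym nearP).
Qed.

End Absorption.

(** The scale drops by the factor 6 for each class: [absorb] takes a buffer bounded at scale [3 * s]
    and returns one bounded at [s'] with [s' + s' <= s], and [s'] has to be 3 times the next
    scale. *)
Fixpoint iter_bound (K m0 r p c : nat) : nat :=
  if c is c'.+1 then
    let M := iter_bound K m0 r p c' in M + absorb_bound K m0 (6 ^ (p - c') * r) M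
  else 0.

Section Iteration.
Variables (T : choiceType) (near : nat -> T -> T -> Prop) (nearP : nearness near).
Variables (J : nat) (k : T -> nat) (p r K m0 : nat).
Variables (E : nat -> nat -> T -> T -> Prop) (A : nat -> T -> Prop).
Hypothesis kJ : forall u, k u <= J.
Hypothesis E_refl : forall c j x, E c j x x.
Hypothesis E_sym : forall c j x y, E c j x y -> E c j y x.
Hypothesis E_trans : forall c j x y z, E c j x y -> E c j y z -> E c j x z.
Hypothesis E_le : forall c i j x y, i <= j -> E c i x y -> E c j x y.
Hypothesis E_near : forall c j u v, c < p ->
  A c u -> A c v -> near (6 ^ p * r) u v -> k u <= j -> E c j u v.
Hypothesis crossing_sparse : forall c j w, c < p ->
  sparse (near m0) K (crossing near k (E c) (A c) (6 ^ p * r) j w).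

Lemma layered_families c : c <= p -> exists W : T -> Prop,
  bounded_chains near W (near (3 * (6 ^ (p - c) * r))) (iter_bound K m0 r p c) /\
  forall c', c' < c -> bounded_chains near (fun u => A c' u /\ ~ W u) (near r)
    (iter_bound K m0 r p c).
Proof.
elim: c => [_|c IH cp]; first by exists (fun=> False); split.
have [W [Wb Wc]] := IH (ltnW cp); set s := 6 ^ (p - c) * r.
have sp : s <= 6 ^ p * r by rewrite leq_mul2r leq_exp2l ?leq_subr ?orbT.
have s6 : s = 6 * (6 ^ (p - c.+1) * r) by rewrite mulnA -expnS subnSK.
have near_s x y : near s x y -> near (6 ^ p * r) x y by apply: (near_le nearP).
have rs : r <= 6 ^ (p - c.+1) * r by rewrite leq_pmull // expn_gt0.
have [|||W' [WW' W'b Ab]] := @absorb _ _ nearP J k (E c) (A c) s m0 K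
  (iter_bound K m0 r p c) W kJ (@E_refl c) (@E_sym c) (@E_trans c) (@E_le c)
  (fun j u v Au Av uv => E_near cp Au Av (near_s _ _ uv)) _ _
  (3 * (6 ^ (p - c.+1) * r)) _.
- move=> j w; apply: sparse_sub (@crossing_sparse c j w cp) => // u [Au ju [x [Ax xj wx xu]]].
  by split=> //; exists x; split=> //; apply: near_s.
- by have -> : s + s + s = 3 * s by lia.
- by lia.
exists W'; split=> // c'; rewrite ltnS leq_eqVlt => /predU1P[->|c'c] u v uA uv.
  apply: (near_le nearP (a := absorb_bound K m0 s (iter_bound K m0 r p c))).
    exact: leq_addl.
  apply: Ab => //; apply: chain_sub uv => x y _ Px Py xy; split=> //.
  by apply: (near_le nearP) xy; lia.
apply: (near_le nearP (a := iter_bound K m0 r p c)); first exact: leq_addr.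
apply: (Wc c') => //; first by case: uA => ? nW'; split=> // /WW'.
by apply: chain_sub uv => x y _ [Ax nx] [Ay ny] xy; split=> //; split=> // /WW'.
Qed.

Lemma layered_coloring : (forall u, exists2 c, c < p & A c u) ->
  exists col : T -> nat, (forall u, col u <= p) /\
    forall c, bounded_chains near (fun u => col u = c) (near r) (iter_bound K m0 r p p).
Proof.
move=> cover; have [W [Wb Wc]] := layered_families (leqnn p).
have ex u : exists c, c <= p /\ (W u /\ c = p \/ [/\ ~ W u, c < p & A c u]).
  have [Wu|nWu] := pselect (W u); first by exists p; split=> //; left.
  by have [c cp cu] := cover u; exists c; split; [exact: ltnW|right].
have [col colP] := choice ex; exists col; split; first by move=> u; case: (colP u).
move=> c; have [cp|pc] := ltnP c p.
  move=> u v cu uv; apply: (Wc c) => //.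
    by have [_ [[_ e]|[nW _]]] := colP u; [lia|rewrite cu].
  apply: chain_sub uv => x y _ cx cy xy; split=> //.
    by have [_ [[_ e]|[nW _]]] := colP x; [lia|rewrite cx].
  by have [_ [[_ e]|[nW _]]] := colP y; [lia|rewrite cy].
have colW x : col x = c -> W x by have [_ [[]|[_ ? _]]] := colP x; [|lia].
move=> u v cu uv; apply: Wb; first exact: colW.
apply: chain_sub uv => x y _ /colW Wx /colW Wy xy; split=> //.
by apply: (near_le nearP) xy; rewrite subnn; lia.
Qed.

End Iteration.

(** * Packings and cells in metric spaces *)

Import Order.TTheory GRing.Theory Num.Theory.

Local Open Scope classical_set_scope.
Local Open Scope ring_scope.

Lemma sparse_cover (T : Type) (near : T -> T -> Prop) (n K : nat)
    (P : 'I_n -> T -> Prop) :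
  (forall i, sparse near K (P i)) ->
  sparse near (n * K) (fun x => exists i, P i x).
Proof.
move=> Psp l lP scat.
have cnt i : (count (fun x => `[< P i x >]) l <= K)%N.
  rewrite -size_filter; apply: (Psp i).
    elim: l {lP scat} => [|x l IH] /=; first by constructor.
    by case: asboolP => //; constructor.
  elim: scat => [|x l' xl _ IH] /=; first by constructor.
  case: asboolP => // _; constructor=> //.
  elim: {IH} xl => [|y l'' xy _ IH] /=; first by constructor.
  by case: asboolP => //; constructor.
have szl : (size l <= \sum_(i < n) count (fun x => `[< P i x >]) l)%N.
  elim: lP {scat cnt} => [|x l' [i Pix] _ IH]; first by rewrite big1.
  rewrite /= big_split /= -add1n leq_add //.
  by rewrite (bigD1 i) //=; case: asboolP.
apply: leq_trans szl _; apply: (@leq_trans (\sum_(i < n) K)%N).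
  by apply: leq_sum => i _; exact: cnt.
by rewrite sum_nat_const card_ord.
Qed.

Section Metric.
Variables (R : realType) (X : Type) (d : X -> X -> \bar R).
Hypothesis dP : extended_metric d.

Definition within (t : R) x y := (d x y <= t%:E)%E.

Lemma within_refl t x : 0 <= t -> within t x x.
Proof. by move=> t0; rewrite /within (emetric_eq0 dP x x).2. Qed.

Lemma within_sym t x y : within t x y -> within t y x.
Proof. by rewrite /within (emetric_sym dP). Qed.

Lemma within_trans a b x y z : within a x y -> within b y z -> within (a + b) x z.
Proof.
move=> xy yz; rewrite /within EFinD.
by apply: le_trans (emetric_triangle dP x y z) _; apply: leeD.
Qed.

Lemma within_le a b x y : a <= b -> within a x y -> within b x y.
Proof. by move=> ab xy; apply: le_trans xy _; rewrite lee_fin. Qed.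

Lemma within0 x y : within 0 x y -> x = y.
Proof.
move=> xy; apply/(emetric_eq0 dP); apply: le_anti.
by rewrite [X in X && _]xy emetric_ge0.
Qed.

Lemma within_diam (U : set X) t x y : (diam d U <= t%:E)%E -> U x -> U y -> within t x y.
Proof.
by move=> Ut Ux Uy; apply: le_trans Ut; apply: ereal_sup_ubound; exists x => //; exists y.
Qed.

Lemma diam_ge0 (U : set X) : U !=set0 -> (0 <= diam d U)%E.
Proof.
move=> [x Ux]; rewrite -((emetric_eq0 dP x x).2 erefl).
by apply: ereal_sup_ubound; exists x => //; exists x.
Qed.

(** Halving the radius [h] times, with [h] depending on [M] only, leads to balls of radius [t / 2],
    in which any two points are within [t]. *)
Lemma doubling_packing : doubling d -> forall M : R, exists K : nat,
  forall x t, 0 < t -> sparse (within t) K (within (M * t) x).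
Proof.
move=> [C C0 dbl] M; pose N := Num.bound C; pose h := (Num.bound `|M|).+1.
have CN : C <= N%:R by apply/ltW/archi_boundP/ltW.
exists (N ^ h)%N => x t t0.
suff main m y : sparse (within t) (N ^ m) (within (2 ^+ m * (t / 2)) y).
  apply: (sparse_sub _ _ (main h x)) => // y; apply: within_le.
  have -> : 2 ^+ h * (t / 2) = 2 ^+ Num.bound `|M| * t by rewrite exprS; field.
  rewrite ler_pM2r //.
  apply: le_trans (ler_norm M) _; apply: le_trans (ltW (archi_boundP (normr_ge0 M))) _.
  by rewrite -natrX ler_nat ltnW // ltn_expl.
elim: m y => [|m IH] y.
  move=> [|u [|v l]] // /List.Forall_cons_iff[yu /List.Forall_cons_iff[yv _]] H.
  inversion H as [|? ? uvl _]; subst.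
  move: uvl => /List.Forall_cons_iff[uv _]; exfalso; apply: uv.
  apply: within_le (within_trans (within_sym yu) yv).
  by rewrite expr0 mul1r -splitr.
have r0 : 0 < 2 ^+ m.+1 * (t / 2) :> R by rewrite mulr_gt0 ?exprn_gt0 ?divr_gt0.
have [n [c [nC cov]]] := dbl _ y r0.
have nN : (n <= N)%N by rewrite -(ler_nat R); apply: le_trans CN.
move=> l lS scat; rewrite expnS; apply: leq_trans (leq_mul nN (leqnn _)).
apply: (sparse_cover (P := fun i => within (2 ^+ m * (t / 2)) (c i))) scat => [i|].
  exact: IH.
apply: List.Forall_impl lS => z /cov[i _ ciz]; exists i.
by move: ciz; rewrite /cball /= /within exprS -mulrA mulrC mulKf ?pnatr_eq0.
Qed.

(* Thickening the cover by [a] turns it into a cover of which [a] is a Lebesgue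
   number. *)
Lemma cells_at_scale n (c0 : R) : control_function d n ( *%R c0) ->
  forall a, 0 < a -> exists cell : nat -> set (set X),
  [/\ forall x, exists i V, [/\ (i < n.+1)%N, cell i V & cball d x a `<=` V],
      forall i V x y, cell i V -> V x -> V y -> within ((3 * c0 + 2) * a) x y &
      forall i V V' x y, cell i V -> cell i V' -> V x -> V' y -> within a x y -> V = V'].
Proof.
move=> [_ ctrl] a a0; have a3 : 0 < 3 * a by rewrite mulr_gt0.
(* The scale is [3 * a] because thickened sets within [a] come from sets within [3 * a]; the
   diameters grow by [2 * a]. *)
have [U [Ucov Udiam Udisj]] := ctrl _ a3.
pose thick (B : set X) := [set y | exists2 z, B z & within a z y].
exists (fun i V => exists (j : 'I_n.+1) B, [/\ j = i :> nat, U j B & V = thick B]).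
split.
- move=> x; have : (\bigcup_(B in \bigcup_i U i) B) x by rewrite Ucov.
  move=> [B [i _ UB] Bx]; exists i, (thick B); split=> //.
    by exists i, B.
  by move=> y xy; exists x.
- move=> i V x y [j [B [_ UB ->]]] [x' Bx' xx'] [y' By' yy'].
  have x'y' : within (c0 * (3 * a)) x' y'.
    by apply: within_diam Bx' By'; apply: Udiam; exists j.
  apply: within_le (within_trans (within_trans (within_sym xx') x'y') yy').
  by rewrite le_eqVlt; apply/orP; left; apply/eqP; ring.
- move=> i V V' x y [j [B [ji UB ->]]] [j' [B' [j'i UB' ->]]] [x' Bx' xx'] [y' By' yy'] xy.
  have jj : j' = j by apply: val_inj; rewrite /= j'i ji.
  rewrite jj in UB'; apply: contrapT => BB'.
  have /(Udisj j _ _ UB UB') : B <> B' by move=> e; apply: BB'; rewrite e.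
  apply/negP; rewrite -leNgt; apply: ge_ereal_inf; exists (d x' y').
    by exists x' => //; exists y'.
  have := within_trans (within_trans xx' xy) (within_sym yy').
  by apply: within_le; lra.
Qed.

Section Cells.
Variables (a C lam : R) (cell : nat -> nat -> set (set X)).
Hypotheses (a0 : 0 < a) (C0 : 0 <= C) (lam4 : 4 <= lam) (lamC : 2 * C <= lam).
Hypothesis cell_diam : forall j i V x y, cell j i V -> V x -> V y ->
  within (C * (a * lam ^+ j)) x y.
Hypothesis cell_disj : forall j i V V' x y, cell j i V -> cell j i V' ->
  V x -> V' y -> within (a * lam ^+ j) x y -> V = V'.

(** Level 0 is excluded, so that [conn i 0] is equality. The relations [conn] provide the node
    equivalences of the tree-decompositions. *)
Definition share_cell i j x y :=
  exists l V, [/\ (0 < l <= j)%N, cell l i V, V x & V y].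

Definition conn i j : X -> X -> Prop := clos_refl_trans X (share_cell i j).

Lemma conn_sym i j x y : conn i j x y -> conn i j y x.
Proof.
elim=> [u v [l [V [lj cV Vu Vv]]]|u|u v w _ uv _ vw]; last exact: rt_trans vw uv.
- by apply: rt_step; exists l, V.
- exact: rt_refl.
Qed.

Lemma conn_le i j j' x y : (j <= j')%N -> conn i j x y -> conn i j' x y.
Proof.
move=> jj; elim=> [u v [l [V [lj cV Vu Vv]]]|u|u v w _ uv _ vw].
- apply: rt_step; exists l, V; split=> //.
  by move: lj => /andP[-> /leq_trans ->].
- exact: rt_refl.
- exact: rt_trans uv vw.
Qed.

Lemma conn0 i x y : conn i 0 x y -> x = y.
Proof.
move: y; apply: clos_refl_trans_ind_left => // u v _ -> [l [V [/andP[l0]]]].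
by rewrite leqn0 => /eqP e; rewrite e in l0.
Qed.

Let lam0 : 0 < lam. Proof. exact: lt_le_trans lam4. Qed.

(* A chain of cells of levels at most [j + 1] goes through at most one cell of
   level [j + 1], since by induction the chains of cells of smaller levels are too
   short to connect two of them. *)
Lemma conn_within i j x y : conn i j x y -> within (2 * C * (a * lam ^+ j)) x y.
Proof.
elim: j x y => [|j IH] x y.
  by move=> /conn0 ->; apply: within_refl; rewrite expr0 mulr1 !mulr_ge0 // ltW.
have aj : 0 <= a * lam ^+ j by rewrite mulr_ge0 ?exprn_ge0 // ltW.
have ajS : a * lam ^+ j.+1 = lam * (a * lam ^+ j) by rewrite exprS mulrCA.
have step : 2 * C * (a * lam ^+ j) <= a * lam ^+ j.+1 by rewrite ajS ler_wpM2r.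
move=> xy; suff [low|[V [x' [y' [cV Vx' Vy' xx' y'y]]]]] : conn i j x y \/ exists V x' y',
    [/\ cell j.+1 i V, V x', V y', conn i j x x' & conn i j y' y].
- apply: within_le (IH _ _ low); apply: ler_wpM2l; first by rewrite mulr_ge0.
  by rewrite ajS ler_peMl //; apply: le_trans lam4; rewrite ler1n.
- apply: within_le (within_trans (within_trans (IH _ _ xx') (cell_diam cV Vx' Vy')) (IH _ _ y'y)).
  have -> : 2 * C * (a * lam ^+ j) + C * (a * lam ^+ j.+1) + 2 * C * (a * lam ^+ j) =
      C * (4 * (a * lam ^+ j)) + C * (a * lam ^+ j.+1) by ring.
  rewrite -mulrDr [2 * C]mulrC -mulrA ler_wpM2l //.
  by rewrite [leRHS]mulrC mulr_natr mulr2n lerD2r ajS ler_wpM2r.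
move: y xy; apply: clos_refl_trans_ind_left; first by left; apply: rt_refl.
move=> y z _ IHy [l [W [/andP[l0 lj] cW Wy Wz]]].
move: lj; rewrite leq_eqVlt ltnS => /predU1P[lj|lj]; last first.
  have yz : conn i j y z by apply: rt_step; exists l, W; rewrite l0 lj.
  case: IHy => [xy|[V [x' [y' [cV Vx' Vy' xx' y'y]]]]].
    by left; apply: rt_trans xy yz.
  by right; exists V, x', y'; split=> //; apply: rt_trans y'y yz.
subst l; right; case: IHy => [xy|[V [x' [y' [cV Vx' Vy' xx' y'y]]]]].
  by exists W, y, z; split=> //; apply: rt_refl.
exists V, x', z; split=> //; last exact: rt_refl.
by rewrite (cell_disj cV cW Vy' Wy (within_le step (IH _ _ y'y))).
Qed.

End Cells.
End Metric.

(** * Intersection graphs of finite families *)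

(** Walks may repeat vertices, so they can be concatenated; they are shortened to paths only for the
    comparison with [gdist]. *)
Definition walk_near (I : eqType) (e : rel I) (n : nat) (i j : I) : Prop :=
  exists p, [/\ path e i p, last i p = j & (size p <= n)%N].

Section Walk.
Variables (I : eqType) (e : rel I).
Hypothesis e_sym : symmetric e.

Lemma walk_nearness : nearness (walk_near e).
Proof.
split.
- by move=> n i; exists [::].
- move=> n i j [p [ep <- pn]]; suff [q [eq lq sq]] : exists q,
      [/\ path e (last i p) q, last (last i p) q = i & size q = size p].
    by exists q; rewrite sq.
  elim: p i ep {pn} => [|k p IH] i /=; first by exists [::].
  move=> /andP[ik /IH[q [eq lq sq]]]; exists (rcons q i).
  by rewrite rcons_path eq lq e_sym ik last_rcons size_rcons sq.
- move=> a b i j k [p [ep <- pa]] [q [eq <- qb]]; exists (p ++ q).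
  by rewrite cat_path ep last_cat size_cat leq_add.
- by move=> a b i j ab [p [ep <- pa]]; exists p; split=> //; apply: leq_trans ab.
Qed.

Lemma walk_near0 i j : walk_near e 0 i j -> i = j.
Proof. by move=> [[|k p] [_ <-]]. Qed.

Lemma walk_nearS n i j : walk_near e n.+1 i j ->
  i = j \/ exists2 k, e i k & walk_near e n k j.
Proof.
move=> [[|k p] [] /=]; first by left.
by move=> /andP[ik ep] <- pn; right; exists k => //; exists p.
Qed.

Lemma walk_near_cons n i k j : e i k -> walk_near e n k j -> walk_near e n.+1 i j.
Proof. by move=> ik [p [ep <- pn]]; exists (k :: p); rewrite /= ik. Qed.

End Walk.

(** By finiteness some [s0] lies below all positive values. Level 0 is for the values [v i <= 0];
    for the others the level is the least [j] with [v i <= s0 * lam ^+ j]. *)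
Lemma levels (R : realType) (N : nat) (v : 'I_N -> R) (lam : R) : 2 <= lam ->
  exists (s0 : R) (lev : 'I_N -> nat), [/\ 0 < s0,
    forall i, lev i = 0%N -> v i <= 0,
    forall i j, (lev i <= j)%N -> v i <= s0 * lam ^+ j &
    forall i j, (j < lev i)%N -> s0 * lam ^+ j < v i].
Proof.
move=> lam2; have lam0 : 0 < lam by apply: lt_le_trans lam2.
have [s0 [s00 s0v]] : exists s0 : R, 0 < s0 /\ forall i, 0 < v i -> s0 < v i.
  suff /(_ (map v (enum 'I_N)))[s0 [s00 s0v]] : forall s : seq R, exists s0 : R,
      0 < s0 /\ forall x, x \in s -> 0 < x -> s0 < x.
    by exists s0; split=> // i; apply: s0v; rewrite map_f ?mem_enum.
  elim=> [|x s [s0 [s00 IH]]]; first by exists 1.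
  exists (if 0 < x then Num.min s0 (x / 2) else s0); split.
    by case: ifP => // x0; rewrite lt_min s00 divr_gt0.
  move=> y; rewrite inE => /predU1P[->|ys] y0.
    by rewrite y0 gt_min; apply/orP; right; lra.
  by case: ifP => [_|_]; rewrite ?gt_min IH.
have lamX j : 0 < s0 * lam ^+ j by rewrite mulr_gt0 ?exprn_gt0.
have ex i : exists j, v i <= s0 * lam ^+ j.
  exists (Num.bound `|v i / s0|); rewrite -ler_pdivrMl // mulrC.
  apply: le_trans (ler_norm _) _; apply: le_trans (ltW (archi_boundP (normr_ge0 _))) _.
  apply: (@le_trans _ _ (2 ^+ Num.bound `|v i / s0|)).
    by rewrite -natrX ler_nat ltnW // ltn_expl.
  by apply: lerXn2r; rewrite ?nnegrE // ltW.
have lev_ex i : exists n, [/\ n = 0%N -> v i <= 0,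
    forall j, (n <= j)%N -> v i <= s0 * lam ^+ j &
    forall j, (j < n)%N -> s0 * lam ^+ j < v i].
  have [v0|v0] := leP (v i) 0.
    by exists 0%N; split=> // j _; apply: le_trans v0 (ltW _).
  have := ex_minnP (ex i); case=> n nP nmin; exists n; split.
  - by move=> n0; move: nP; rewrite n0 expr0 mulr1 leNgt s0v.
  - move=> j nj; apply: le_trans nP _; rewrite ler_pM2l //.
    by apply: ler_weXn2l => //; apply: le_trans lam2; rewrite ler1n.
  - by move=> j jn; rewrite ltNge; apply/negP => /nmin; rewrite leqNgt jn.
have [lev levP] := choice lev_ex.
by exists s0, lev; split=> // i; have [] := levP i.
Qed.

Section FiniteFamily.
Variables (R : realType) (X : Type) (d : X -> X -> \bar R).
Hypothesis dP : extended_metric d.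
Variables (N : nat) (A : 'I_N -> set X).
Hypothesis A_ex : forall i, A i !=set0.
Let near := walk_near (inter_adj A).
Let nearP : nearness near := walk_nearness (inter_adj_sym A).

Lemma meet_near n i j : (0 < n)%N -> A i `&` A j !=set0 -> near n i j.
Proof.
move=> n0 ij; have [->|ij'] := eqVneq i j; first by apply: (near_refl nearP).
by exists [:: j]; split=> //=; rewrite /inter_adj ij' andbT; apply/asboolP.
Qed.

Lemma walk_within n (e : R) i j x y : 0 <= e ->
  (forall k, near n i k -> (diam d (A k) <= e%:E)%E) -> near n i j ->
  A i x -> A j y -> within d (n.+1%:R * e) x y.
Proof.
move=> e0; elim: n i x => [|n IH] i x small ij Aix Ajy.
  rewrite mul1r; rewrite -(walk_near0 ij) in Ajy.
  by apply: within_diam Aix Ajy; apply/small/(near_refl nearP).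
have xA z : A i z -> within d e x z.
  by move=> Aiz; apply: within_diam Aix Aiz; apply/small/(near_refl nearP).
case: (walk_nearS ij) => [e'|[k ik kj]].
  apply: within_le (xA y _); last by rewrite e'.
  by rewrite ler_peMl // ler1n.
have [z [Aiz Akz]] : A i `&` A k !=set0 by move: ik => /andP[_ /asboolP].
have kz : within d (n.+1%:R * e) z y.
  by apply: IH Akz Ajy => // l kl; apply/small/(walk_near_cons ik).
by apply: within_le (within_trans dP (xA z Aiz) kz); rewrite -[n.+2%:R]natr1 mulrDl mul1r addrC.
Qed.

Lemma walk_first n (e : R) (large : 'I_N -> Prop) i j x : 0 <= e ->
  (forall k, ~ large k -> (diam d (A k) <= e%:E)%E) -> near n i j -> large j -> A i x ->
  exists k, [/\ near n i k, large k & exists2 y, A k y & within d (n%:R * e) x y].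
Proof.
move=> e0 small; elim: n i x => [|n IH] i x ij lj Aix.
  rewrite -(walk_near0 ij) in lj; exists i; split=> //; first by apply: (near_refl nearP).
  by exists x => //; apply: within_refl; rewrite // mul0r.
have [li|nli] := pselect (large i).
  exists i; split=> //; first by apply: (near_refl nearP).
  by exists x => //; apply: within_refl; rewrite // mulr_ge0.
case: (walk_nearS ij) => [e'|[k ik kj]]; first by rewrite e' in nli.
have [z [Aiz Akz]] : A i `&` A k !=set0 by move: ik => /andP[_ /asboolP].
have [l [kl ll [y Aly zy]]] := IH k z kj lj Akz.
exists l; split=> //; first exact: walk_near_cons ik kl.
exists y => //; apply: within_le (within_trans dP (within_diam (small _ nli) Aix Aiz) zy).
by rewrite -natr1 mulrDl mul1r addrC.
Qed.

End FiniteFamily.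

Section FiniteColoring.
Variables (R : realType) (X : Type) (d : X -> X -> \bar R) (n r : nat) (c0 eta : R).
Hypotheses (dP : extended_metric d) (d_dbl : doubling d).
Hypotheses (d_ctrl : control_function d n ( *%R c0)) (c0_gt0 : 0 < c0) (eta_gt0 : 0 < eta).

(** [R0] is the coarsest scale of the iteration over [n.+1] classes. [C] is the diameter constant of
    [cells_at_scale], and [lam = 2 * C] is what [conn_within] asks for. *)
Let R0 := (6 ^ n.+1 * r)%N.
Let lam : R := 6 * c0 + 4.
Let C : R := 3 * c0 + 2.

Lemma lam_ge4 : 4 <= lam. Proof. by rewrite /lam; have := c0_gt0; lra. Qed.
Lemma lamC : 2 * C <= lam. Proof. by rewrite /lam /C; lra. Qed.
Lemma C_ge0 : 0 <= C. Proof. by rewrite /C; have := c0_gt0; lra. Qed.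
Lemma lam_gt0 : 0 < lam. Proof. exact: lt_le_trans lam_ge4. Qed.

Section Family.
Variables (N : nat) (A : 'I_N -> set X).
Hypotheses (A_ex : forall i, A i !=set0) (A_round : forall i, round d eta (A i)).
Let near := walk_near (inter_adj A).
Let nearP : nearness near := walk_nearness (inter_adj_sym A).

Variables (s0 : R) (lev : 'I_N -> nat).
Hypothesis s0_gt0 : 0 < s0.
Hypothesis lev0 : forall i, lev i = 0%N -> (diam d (A i) <= 0)%E.
Hypothesis lev_le : forall i j, (lev i <= j)%N -> (diam d (A i) <= (s0 * lam ^+ j)%:E)%E.
Hypothesis lev_gt : forall i j, (j < lev i)%N -> ((s0 * lam ^+ j)%:E <= diam d (A i))%E.

(** A walk of at most [R0] steps from [u] visits at most [R0.+1] sets, each of diameter at most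
    [s0 * lam ^+ k u]; they all lie in the ball of radius [a * lam ^+ k u] around [pt u]. *)
Let a := R0.+1%:R * s0.
Variable cell : nat -> nat -> set (set X).
Hypothesis cell_cover : forall j x, exists i V,
  [/\ (i < n.+1)%N, cell j i V & cball d x (a * lam ^+ j) `<=` V].
Hypothesis cell_diam : forall j i V x y, cell j i V -> V x -> V y ->
  within d (C * (a * lam ^+ j)) x y.
Hypothesis cell_disj : forall j i V V' x y, cell j i V -> cell j i V' ->
  V x -> V' y -> within d (a * lam ^+ j) x y -> V = V'.

Variables (k : 'I_N -> nat) (pt : 'I_N -> X).
Hypothesis k_ex : forall u, exists2 v, near R0 u v & lev v = k u.
Hypothesis k_max : forall u v, near R0 u v -> (lev v <= k u)%N.
Hypothesis ptP : forall u, A u (pt u).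

Definition node_conn c j u v := conn cell c j (pt u) (pt v).
(* [k u] is the largest level of a set within distance [R0] of [u]; it is [0] only
   if all these sets are the same point. *)
Definition deep c u := k u = 0%N \/
  exists V, cell (k u) c V /\ forall v, near R0 u v -> A v `<=` V.

Variable K : nat.
Hypothesis packing : forall x t, 0 < t -> sparse (within d t) K
  (within d ((2 * C * R0.+1%:R * lam + 2 * R0%:R + 1) / eta * t) x).

Let lamX j : 0 < s0 * lam ^+ j.
Proof. by rewrite mulr_gt0 ?exprn_gt0 ?lam_gt0. Qed.

Lemma deep_cover u : exists2 c, (c < n.+1)%N & deep c u.
Proof.
have [i [V [iN cV xV]]] := cell_cover (k u) (pt u); exists i => //; right.
exists V; split=> // v uv y Avy; apply: xV; rewrite /cball /= /a -mulrA.
apply: (walk_within dP (A := A) (i := u) (j := v)) => //; first exact: ltW.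
by move=> w uw; apply/lev_le/k_max.
Qed.

Lemma k0_pt u v : k u = 0%N -> near R0 u v -> A v (pt u) /\ pt v = pt u.
Proof.
move=> ku uv; suff sub y : A v y -> y = pt u.
  by have [y Avy] := A_ex v; rewrite -{1}(sub y Avy); split=> //; apply/sub/ptP.
move=> Avy; apply/esym/(within0 dP).
rewrite -[0](mulr0 R0.+1%:R).
apply: (walk_within dP (A := A) (i := u) (j := v)) => // w uw.
by apply: lev0; have := k_max uw; rewrite ku leqn0 => /eqP.
Qed.

Lemma deep_conn c j u v : deep c u -> near R0 u v -> (k u <= j)%N -> node_conn c j u v.
Proof.
move=> [ku uv _|[V [cV sub]] uv kj].
  by have [_ e] := k0_pt ku uv; rewrite /node_conn e; apply: rt_refl.
have [k0|k0] := eqVneq (k u) 0%N.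
  by have [_ e] := k0_pt k0 uv; rewrite /node_conn e; apply: rt_refl.
apply: rt_step; exists (k u), V; split=> //; first by rewrite lt0n k0.
  by apply: (sub u) => //; apply: (near_refl nearP).
exact: (sub v).
Qed.

(* On a walk from [x] at level at most [j] to a set of level [j + 1], the first set
   of level [j + 1] is close to [x] in [X] as well; roundness and doubling bound the
   number of pairwise disjoint such sets. *)
Lemma crossing_portals c j w : sparse (near (3 * R0 + 1 + 3 * R0)) K.+1
  (crossing near k (node_conn c) (deep c) R0 j w).
Proof.
case: j => [|j].
  (* At level 0 all the sets in question contain [pt w], so a scattered list has at most one
     element; hence the bound [K.+1]. *)
  move=> [|u [|v l]] // /List.Forall_cons_iff[cu /List.Forall_cons_iff[cv _]] H.
  inversion H as [|? ? uvl _]; subst.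
  move: uvl => /List.Forall_cons_iff[uv _]; exfalso; apply: uv.
  have ptw u' : crossing near k (node_conn c) (deep c) R0 0 w u' -> A u' (pt w).
    move=> [_ _ [x [_ kx wx xu]]].
    have kx0 : k x = 0%N by lia.
    by have [Apt _] := k0_pt kx0 xu; rewrite (conn0 wx).
  apply: (near_le nearP (a := 1)); first by rewrite addn1 addSn.
  by apply: meet_near => //; exists (pt w); split; apply: ptw.
have t0 : 0 < eta * (s0 * lam ^+ j) by apply: mulr_gt0.
suff: sparse (near (3 * R0 + 1 + 3 * R0)) K
    (crossing near k (node_conn c) (deep c) R0 j.+1 w).
  by move=> sp l lS scat; apply: leq_trans (sp l lS scat) _.
(* [rho] links a set to the centre of a ball inside a set near it in the graph; two such sets meet
   once the centres are within the radius of the balls. *)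
pose rho u y := exists v, [/\ near (3 * R0) u v, A v y &
  cball d y (eta * (s0 * lam ^+ j)) `<=` A v].
apply: (sparse_map (rho := rho) _ _ (@packing (pt w) _ t0)).
- move=> u [_ ju [x [_ kx wx xu]]]; have [T uT levT] := k_ex u.
  have xT : near (R0 + R0) x T by apply: (near_trans nearP) uT.
  have [||v [xv jv [q Avq xq]]] := @walk_first _ _ _ dP N A (R0 + R0) (s0 * lam ^+ j)
    (fun v => (j < lev v)%N) x T (pt x) (ltW (lamX j)) _ xT _ (ptP x).
  - by move=> v /negP; rewrite -leqNgt; apply: lev_le.
  - by rewrite levT.
  have [_ /(_ q (s0 * lam ^+ j) Avq (lamX j) (lev_gt jv))[y Avy yball]] := A_round v.
  exists y.
  - have qy : within d (s0 * lam ^+ j) q y.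
      by have [] := yball y (within_refl dP _ (ltW t0)).
    have wx' := conn_within dP (a := a) _ C_ge0 lam_ge4 lamC cell_diam cell_disj wx.
    have a_gt0 : 0 < a by rewrite /a mulr_gt0.
    (* In the packing constant, [2 * C * R0.+1%:R * lam] comes from the node of level [j.+1],
       [2 * R0%:R] from the walk to [v], and 1 from the step from [q] to [y]. *)
    apply: within_le (within_trans dP (within_trans dP (wx' a_gt0) xq) qy).
    rewrite le_eqVlt; apply/orP; left; apply/eqP; rewrite /a exprS natrD.
    by field; apply: lt0r_neq0.
  - exists v; split=> //; last by move=> z /yball[].
    have := near_trans nearP (near_sym nearP xu) xv.
    by apply: (near_le nearP); lia.
- move=> u u' y y' [v [uv Avy yb]] [v' [u'v' Av'y' _]] yy'.
  have vv' : near 1 v v' by apply: meet_near => //; exists y'; split=> //; apply: yb.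
  exact: (near_trans nearP) (near_trans nearP uv vv') (near_sym nearP u'v').
Qed.

End Family.

(** [D] is chosen before the family, as compactness requires: levels and cells depend on the family,
    the bound does not. *)
Theorem finite_coloring : exists D, forall (N : nat) (A : 'I_N -> set X),
  (forall i, A i !=set0) -> (forall i, round d eta (A i)) ->
  exists col : 'I_N -> nat, (forall i, (col i <= n.+1)%N) /\
    forall c, bounded_chains (walk_near (inter_adj A)) (fun i => col i = c)
      (walk_near (inter_adj A) r) D.
Proof.
have [K packing] := doubling_packing dP d_dbl
  ((2 * C * R0.+1%:R * lam + 2 * R0%:R + 1) / eta).
exists (iter_bound K.+1 (3 * R0 + 1 + 3 * R0) r n.+1 n.+1) => N A A_ex A_round.
pose v i := fine (diam d (A i)).
have vE i : diam d (A i) = (v i)%:E.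
  by rewrite fineK // ge0_fin_numE ?(diam_ge0 dP) //; case: (A_round i).
have lam2 : 2 <= lam by apply: le_trans lam_ge4; rewrite ler_nat.
have [s0 [lev [s0_gt0 lev0 lev_le lev_gt]]] := levels v lam2.
have a0 j : 0 < R0.+1%:R * s0 * lam ^+ j.
  by rewrite !mulr_gt0 ?exprn_gt0 ?lam_gt0.
have /choice[cell cellP] := fun j => cells_at_scale dP d_ctrl (a0 j).
pose near := walk_near (inter_adj A).
have nearP : nearness near := walk_nearness (inter_adj_sym A).
have /choice[k kP] u : exists m, (exists2 w, near R0 u w & lev w = m) /\
    forall w, near R0 u w -> (lev w <= m)%N.
  pose P m := `[< exists2 w, near R0 u w & lev w = m >].
  have exP : exists m, P m.
    by exists (lev u); apply/asboolP; exists u => //; apply: (near_refl nearP).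
  have PJ m : P m -> (m <= \max_w lev w)%N.
    by move=> /asboolP[w _ <-]; apply: leq_bigmax.
  have := ex_maxnP exP PJ; case=> m /asboolP Pm mmax; exists m; split=> // w uw.
  by apply: mmax; apply/asboolP; exists w.
have /choice[pt ptP] := A_ex.
have kJ u : (k u <= \max_w lev w)%N.
  by have [[w _ <-] _] := kP u; apply: leq_bigmax.
have kex u : exists2 w, near R0 u w & lev w = k u by case: (kP u).
have kmax u w : near R0 u w -> (lev w <= k u)%N by case: (kP u) => _; apply.
have lev0' i : lev i = 0%N -> (diam d (A i) <= 0)%E.
  by move=> /lev0; rewrite vE lee_fin.
have lev_le' i j : (lev i <= j)%N -> (diam d (A i) <= (s0 * lam ^+ j)%:E)%E.
  by move=> /lev_le; rewrite vE lee_fin.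
have lev_gt' i j : (j < lev i)%N -> ((s0 * lam ^+ j)%:E <= diam d (A i))%E.
  by move=> /lev_gt/ltW; rewrite vE lee_fin.
apply: (@layered_coloring _ _ nearP _ k n.+1 r K.+1 (3 * R0 + 1 + 3 * R0)
  (node_conn cell pt) (deep A cell k) kJ).
- by move=> *; apply: rt_refl.
- by move=> *; apply: conn_sym.
- by move=> c j x y z xy yz; apply: rt_trans xy yz.
- by move=> *; apply: conn_le; eassumption.
- move=> c j u w _ du _ uw kj.
  exact: (deep_conn A_ex lev0' kmax ptP du uw kj).
- move=> c j w _.
  by apply: (crossing_portals A_ex A_round s0_gt0 lev0' lev_le' lev_gt' _ _ kex kmax ptP packing);
    move=> j'; have [] := cellP j'.
- move=> u; apply: (deep_cover s0_gt0 lev_le' _ kmax ptP) => //.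
  by move=> j'; have [] := cellP j'.
Qed.

End FiniteColoring.

(** * Infinite families *)

(** Some ultrafilter on the lists [s] contains, for each [s0], the set of all [s] including [s0];
    [col x] is the value that [c s x] takes for almost all [s]. *)
Lemma coloring_compactness (I : eqType) (m : nat) (good : seq I -> (I -> nat) -> Prop) :
  (forall s, exists c : I -> nat, (forall x, (c x <= m)%N) /\ good s c) ->
  exists col : I -> nat, (forall x, (col x <= m)%N) /\
    forall s0 : seq I, exists s c,
      [/\ {subset s0 <= s}, good s c & {in s0, forall x, c x = col x}].
Proof.
move=> /choice[c cP].
pose F : set_system (seq I) := [set P | exists s0 : seq I, forall s : seq I, {subset s0 <= s} -> P s].
have FF : ProperFilter F.
  apply: Build_ProperFilter_ex.
    by move=> P [s0 /(_ s0 (fun _ => id)) Ps]; exists s0.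
  split.
  - by exists [::].
  - move=> P Q [s0 Ps] [s1 Qs]; exists (s0 ++ s1) => s ss; split.
      by apply: Ps => x xs; apply: ss; rewrite mem_cat xs.
    by apply: Qs => x xs; apply: ss; rewrite mem_cat xs orbT.
  - by move=> P Q PQ [s0 Ps]; exists s0 => s /Ps/PQ.
have [G [GU FG]] := ultraFilterLemma FF.
have GP : ProperFilter G by exact: ultra_proper.
have GT (P : set (seq I)) : (forall s, P s) -> G P.
  move=> Ps; have -> : P = setT by apply/seteqP; split=> // s _; apply: Ps.
  exact: filterT.
have GS (P Q S : set (seq I)) : (forall s, P s -> Q s -> S s) -> G P -> G Q -> G S.
  move=> PQS GP' GQ; have PQ := @filterI _ G GP P Q GP' GQ.
  by apply: (@filterS _ G GP _ _ _ PQ) => s [Ps Qs]; apply: PQS.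
have /choice[col colP] x : exists i, (i <= m)%N /\ G [set s | c s x = i].
  apply: contrapT => no.
  have : G [set s | (m < c s x)%N].
    suff H i : (i <= m.+1)%N -> G [set s | (i <= c s x)%N] by apply: H.
    elim: i => [_|i IH im]; first exact: GT.
    have [Gi|Gi] := in_ultra_setVsetC [set s | c s x = i] GU.
      by exfalso; apply: no; exists i.
    apply: GS (IH (ltnW im)) Gi => s /= si sni.
    by rewrite ltn_neqAle si andbT eq_sym; apply/eqP.
  move=> h; have [s /= ms] := filter_ex h; have [cs _] := cP s.
  by move: ms; rewrite ltnNge cs.
exists col; split=> [x|s0]; first by case: (colP x).
have : G [set s | {in s0, forall x, c s x = col x}].
  elim: s0 => [|x s0 IH]; first exact: GT.
  apply: GS IH (colP x).2 => s /= h hx y.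
  by rewrite inE => /predU1P[->|/h].
have G1 : G [set s : seq I | {subset s0 <= s}] by apply: FG; exists s0.
move=> G2; have [s /= [ss sc]] := filter_ex (@filterI _ G GP _ _ G1 G2).
by exists s, (c s); split=> //; case: (cP s).
Qed.

Lemma path_neighbors (I : eqType) (X : Type) (A : I -> set X) x p :
  A x !=set0 -> path (inter_adj A) x p -> {in x :: p, forall y, A y !=set0}.
Proof.
elim: p x => [|y p IH] x Ax /=; first by move=> _ z; rewrite inE => /eqP ->.
move=> /andP[/andP[_ /asboolP[w [_ Ayw]]] yp] z; rewrite inE => /predU1P[->//|].
by apply: (IH y _ yp); exists w.
Qed.

Definition walk_in (I : eqType) (e : rel I) (s : seq I) (n : nat) (i j : I) : Prop :=
  exists p, [/\ path e i p, last i p = j, (size p <= n)%N & {subset i :: p <= s}].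

Section Infinite.
Variables (R : realType) (X : Type) (d : X -> X -> \bar R) (n r : nat) (c0 eta : R).
Variable D : nat.
Hypothesis finite : forall (N : nat) (A : 'I_N -> set X),
  (forall i, A i !=set0) -> (forall i, round d eta (A i)) ->
  exists col : 'I_N -> nat, (forall i, (col i <= n.+1)%N) /\
    forall c, bounded_chains (walk_near (inter_adj A)) (fun i => col i = c)
      (walk_near (inter_adj A) r) D.
Variables (I : eqType) (A : I -> set X).
Hypothesis A_round : forall i, round d eta (A i).

Lemma subfamily_coloring (s : seq I) : exists c : I -> nat,
  (forall x, (c x <= n.+1)%N) /\ forall k, bounded_chains (walk_near (inter_adj A))
    (fun x => A x !=set0 /\ c x = k) (walk_in (inter_adj A) s r) D.
Proof.
(* [finite] wants nonempty sets, and empty ones are isolated vertices; without repetitions [f] is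
   injective. *)
pose t := undup [seq x <- s | `[< A x !=set0 >]].
pose f := tnth (in_tuple t).
have f_inj : injective f by apply/tuple_uniqP/undup_uniq.
have f_ex i : A (f i) !=set0.
  have := mem_tnth i (in_tuple t); rewrite -/f /= mem_undup mem_filter.
  by move=> /andP[/asboolP].
have [col [col_le colb]] := finite f_ex (fun i => A_round (f i)).
have ex x : exists k, (k <= n.+1)%N /\ forall i, f i = x -> k = col i.
  have [[i fi]|no] := pselect (exists i, f i = x); last first.
    by exists 0%N; split=> // i fi; case: no; exists i.
  by exists (col i); split=> // j; rewrite -fi => /f_inj ->.
have [c cP] := choice ex; have cf i : c (f i) = col i.
  by have [_ h] := cP (f i); apply: h.
have adjf i j : inter_adj A (f i) (f j) = inter_adj (A \o f) i j.
  by rewrite /inter_adj inj_eq.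
have pathf i p : path (inter_adj A) (f i) (map f p) = path (inter_adj (A \o f)) i p.
  by rewrite path_map; apply: eq_path.
have lift x : A x !=set0 -> x \in s -> exists i, f i = x.
  move=> Ax xs; have /tnthP[i ->] : x \in in_tuple t; last by exists i.
  by rewrite /= mem_undup mem_filter xs andbT; apply/asboolP.
exists c; split=> [x|k u v [Au cu] uv]; first by case: (cP x).
have [->|[i [j [fi fj ij]]]] : v = u \/ exists i j, [/\ f i = u, f j = v &
    chain (fun i => col i = k) (walk_near (inter_adj (A \o f)) r) i j].
- move: v uv; apply: chain_ind; first by left.
  move=> v w _ IHv [Av cv] [Aw cw] [p [ep lp pr ps]].
  have [q qE] : exists q, map f q = v :: p.
    have : {in v :: p, forall x, exists i, f i = x}.
      by move=> x xp; apply: lift; [apply: path_neighbors ep x xp|apply: ps].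
    elim: (v :: p) => [|x l IH] h; first by exists [::].
    have [i fi] := h x (mem_head _ _).
    have [q ql] : exists q, map f q = l by apply: IH => y yl; apply: h; rewrite inE yl orbT.
    by exists (i :: q); rewrite /= fi ql.
  case: q qE => // j q [fj qp]; right.
  have jw : f (last j q) = w by rewrite -last_map qp fj.
  have step : chain (fun i => col i = k) (walk_near (inter_adj (A \o f)) r) j (last j q).
    apply: chain_step; rewrite -?cf ?fj ?jw //.
    by exists q; split=> //; [rewrite -pathf fj qp|rewrite -(size_map f) qp].
  case: IHv => [e|[i [j' [fi fj' ij]]]].
    by exists j, (last j q); split=> //; rewrite -e fj.
  exists i, (last j q); split=> //; apply: rt_trans ij _.
  by rewrite (f_inj j' j) // fj' fj.
- exact: near_refl (walk_nearness (inter_adj_sym A)) _ _.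
have [|p [ep lp pD]] := colb k i j _ ij; first by rewrite -cf fi.
exists (map f p); split; first by rewrite -fi pathf.
- by rewrite -fi last_map lp fj.
- by rewrite size_map.
Qed.

Lemma infinite_coloring : exists col : I -> nat, (forall x, (col x <= n.+1)%N) /\
  forall k, bounded_chains (walk_near (inter_adj A)) (fun x => col x = k)
    (walk_near (inter_adj A) r) D.
Proof.
have [col [col_le colP]] := coloring_compactness subfamily_coloring.
exists col; split=> // k u v cu uv.
have [Au|nAu] := pselect (A u !=set0); last first.
  suff -> : v = u by apply: near_refl (walk_nearness (inter_adj_sym A)) _ _.
  move: v uv; apply: chain_ind => // v w _ -> _ _ [[|x p] [/=]]; first by [].
  by move=> /andP[/andP[_ /asboolP[z [Az _]]]]; case: nAu; exists z.
(* A chain and its walks visit finitely many vertices, collected in [s0]; so the chain survives in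
   every larger subfamily whose colouring agrees with [col] on [s0]. *)
have [s0 us0 s0P] : exists2 s0 : seq I, A v !=set0 & forall s c, {subset s0 <= s} ->
    {in s0, forall x, c x = col x} ->
    chain (fun x => A x !=set0 /\ c x = k) (walk_in (inter_adj A) s r) u v.
  move: v uv; apply: chain_ind; first by exists [::] => // s c _ _; apply: rt_refl.
  move=> v w _ [s0 Av s0P] cv cw [p [ep lp pr]].
  have Aw : A w !=set0 by apply: (path_neighbors Av ep); rewrite -lp mem_last.
  exists (s0 ++ v :: p) => // s c ss sc.
  apply: rt_trans (s0P s c _ _) (chain_step _ _ _).
  - by move=> x xs; apply: ss; rewrite mem_cat xs.
  - by move=> x xs; apply: sc; rewrite mem_cat xs.
  - by split=> //; rewrite sc // mem_cat mem_head orbT.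
  - by split=> //; rewrite sc // mem_cat -lp mem_last orbT.
  - by exists p; split=> // x xp; apply: ss; rewrite mem_cat xp orbT.
have [s [c [ss good sc]]] := colP (u :: s0).
apply: (good k); first by rewrite sc ?mem_head.
apply: s0P => x xs; last by apply: sc; rewrite inE xs orbT.
by apply: ss; rewrite inE xs orbT.
Qed.

End Infinite.

(** * From colourings to control functions *)

Lemma walk_near_gdist (R : realType) (G : sgraph) n (u v : vertex G) :
  walk_near (@adj G) n u v -> (gdist R u v <= n%:R%:E)%E.
Proof.
move=> [p [ep <- pn]]; case: (shortenP ep) => q eq uq sq.
apply: ge_ereal_inf; exists (size q)%:R%:E; first by exists q.
rewrite lee_fin ler_nat; apply: leq_trans pn; apply: uniq_leq_size => //.
by move: uq => /= /andP[].
Qed.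

Lemma gdist_ge (R : realType) (G : sgraph) n (u v : vertex G) :
  ~ walk_near (@adj G) n u v -> (n.+1%:R%:E <= gdist R u v)%E.
Proof.
move=> nuv; apply: le_ereal_inf_tmp => _ [p [ep _ lp] <-].
by rewrite lee_fin ler_nat ltnNge; apply/negP => pn; apply: nuv; exists p.
Qed.

Lemma coloring_control (R : realType) (G : sgraph) (m D : nat) (r : R)
    (col : vertex G -> nat) : 0 < r -> (forall x, (col x <= m)%N) ->
  (forall k, bounded_chains (walk_near (@adj G)) (fun x => col x = k)
    (walk_near (@adj G) (Num.truncn r)) D) ->
  exists U : 'I_m.+1 -> set (set (vertex G)),
    [/\ \bigcup_(A in \bigcup_i U i) A = setT,
        forall A, (\bigcup_i U i) A -> (diam (@gdist R G) A <= D%:R%:E)%E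
      & forall i, rdisjoint (@gdist R G) r (U i)].
Proof.
move=> r0 col_le colb; have nearP := walk_nearness (@adj_sym G).
pose comp (i : nat) u := [set v |
  chain (fun x => col x = i) (walk_near (@adj G) (Num.truncn r)) u v].
have comp_sym i u v : comp i u v -> comp i v u.
  by apply: chain_sym => x y; apply: (near_sym nearP).
exists (fun i => [set B | exists2 u, col u = i & B = comp i u]); split.
- apply/seteqP; split=> // u _; have ui : (col u < m.+1)%N by rewrite ltnS.
  by exists (comp (col u) u); [exists (Ordinal ui) => //; exists u|apply: rt_refl].
- move=> B [i _ [u cu ->]]; apply: ge_ereal_sup => _ [x ux [y uy <-]].
  apply: walk_near_gdist; apply: (colb i); first exact: chain_in ux.
  by apply: rt_trans uy; apply: comp_sym.
- move=> i B B' [u cu ->] [u' cu' ->] BB'.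
  (* Graph distances are integers, so beyond [Num.truncn r] they are at least [(Num.truncn r).+1],
     which exceeds [r]. *)
  apply: (@lt_le_trans _ _ (Num.truncn r).+1%:R%:E).
    by rewrite lte_fin; have /andP[] := truncn_itv (ltW r0).
  apply: le_ereal_inf_tmp => _ [x ux [y uy <-]]; apply: gdist_ge => xy.
  apply: BB'; have cx := chain_in cu ux; have cy := chain_in cu' uy.
  have uu' : comp i u u'.
    apply: rt_trans ux _; apply: rt_trans (chain_step cx cy xy) _; exact: comp_sym.
  apply/seteqP; split=> v; first by apply: rt_trans; apply: comp_sym.
  exact: rt_trans uu'.
Qed.

Theorem corollary1p5 (R : realType) (n : nat) (eta : R) (X : Type)
    (d : X -> X -> \bar R) :
  (0 < n)%N -> 0 < eta ->
  extended_metric d -> doubling d ->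
  (assouad_nagata_dim d <= (n%:R)%:E)%E ->
  (asdim R (round_intersection_graphs d eta) <= (n.+1%:R)%:E)%E.
Proof.
move=> _ eta0 dP dbl /least_nat_leP[m [g [c0 c00 gE] ctrl] mn].
(* The dimension [m] of the space may be smaller than [n]; [m.+2] colours give control in dimension
   [m.+1]. *)
apply/least_nat_leP; exists m.+1; last by rewrite ltnS.
have {}ctrl : control_function d m ( *%R c0).
  by have <- : g = *%R c0 by apply/funext.
have /choice[D DP] := fun r => @finite_coloring R X d m r c0 eta dP dbl ctrl c00 eta0.
exists (fun r => (D (Num.truncn r))%:R) => _ [I [A [A_round ->]]]; split=> // r r0.
have [col [col_le colb]] := infinite_coloring (DP (Num.truncn r)) A_round.
exact: (coloring_control (G := intersection_graph A) r0 col_le colb).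
Qed.
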